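(* Let $m$ be a positive integer, let $c\ge 2$ be a real number, and let $G$ be a graph with a factor $F$. Assume that every $m$-tree-connected component $C$ of $F$ satisfies $|V(C)|+\frac{c-1}{2m}d_F(C)\ge c$. Let $h$ be a nonnegative integer-valued function on $V(G)$. If for all $S\subseteq V(G)$, $$\Omega_m(G\setminus S)<\sum_{v\in S}\Big(\frac{c}{2c-2}h(v)-\frac{m}{c-1}\Big)+m+1+\frac{1}{c-1}\Omega_m(G[S]),$$ then $G$ has an $m$-tree-connected factor $H$ containing $F$ such that for each vertex $v$, $d_H(v)\le h(v)+d_F(v)$.
   Context: Graphs are finite, nonnull (except possibly those obtained by removing vertices), have no loops, and may have multiple edges. A factor of $G$ is a spanning subgraph of $G$. $d_G(v)$ is the number of edges of $G$ incident to $v$. For a subgraph $C$ of $F$, $d_F(C)$ is the number of edges of $F$ with exactly one end in $V(C)$. $G\setminus S$ is the graph obtained from $G$ by deleting the vertices of $S$; $G[S]$ is the subgraph induced by $S$. A graph is $m$-tree-connected if it has $m$ edge-disjoint spanning trees (a one-vertex graph is $m$-tree-connected; the null graph $K_0$ with no vertices is not). The vertex set of any graph is uniquely a disjoint union of vertex sets of (maximal) induced $m$-tree-connected subgraphs, called its $m$-tree-connected components. $\Omega_m(G)=m|P|-e_G(P)$, where $P$ is the partition of $V(G)$ given by the vertex sets of the $m$-tree-connected components of $G$ and $e_G(P)$ is the number of edges of $G$ whose ends lie in different parts of $P$; $\Omega_m(K_0)=0$. *)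

(* Defs.v *)
From HB Require Import structures.
From mathcomp Require Import all_boot all_order all_algebra.
From mathcomp Require Import boolp reals.

Set Implicit Arguments.
Unset Strict Implicit.
Unset Printing Implicit Defensive.

Import Order.TTheory GRing.Theory Num.Theory.

(* Loopless multigraphs: an edge has exactly two distinct ends, and different
   edges may have the same ends.  The graph with no vertices is allowed. *)
Record mgraph := MGraph {
  vertex :> finType;
  edge : finType;
  ends : edge -> {set vertex};
  card_ends : forall e, #|ends e| = 2
}.

Record subgraph (G : mgraph) := Subgraph {
  sv : {set G};
  se : {set edge G};
  se_sub : forall e, e \in se -> ends e \subset sv
}.

Section Defs.
Variable G : mgraph.
Implicit Types (H K : subgraph G) (A S : {set G}) (v : G) (m : nat).

Lemma whole_subproof (e : edge G) :
  e \in [set: edge G] -> ends e \subset [set: G].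
Proof. by move=> _; exact: subsetT. Qed.

Definition whole : subgraph G := Subgraph whole_subproof.

Definition subgraph_le K H := (sv K \subset sv H) && (se K \subset se H).

Definition factor H := sv H == [set: G].

Lemma induced_subproof H A (e : edge G) :
  e \in [set f in se H | ends f \subset A] -> ends e \subset sv H :&: A.
Proof. by rewrite inE subsetI => /andP[/se_sub -> ->]. Qed.

Definition induced H A : subgraph G := Subgraph (@induced_subproof H A).

Definition delete H S : subgraph G := induced H (~: S).

Definition degree H v := #|[set e in se H | v \in ends e]|.

Definition cut_degree H A := #|[set e in se H | #|ends e :&: A| == 1]|.

Definition adj H : rel G :=
  fun x y => [exists e in se H, ends e == [set x; y]].

Definition connected H := {in sv H &, forall x y, connect (adj H) x y}.

(* A cycle x_0 e_0 x_1 e_1 ... x_k e_k x_0 is given as the sequence of the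
   pairs (x_i, e_i); since there are no loops it has at least two edges, and
   two parallel edges form a cycle. *)
Definition is_cycle H (s : seq (G * edge G)) :=
  [&& s != [::], uniq (unzip1 s), uniq (unzip2 s),
      all (fun p => p.2 \in se H) s
    & cycle (fun p q => ends p.2 == [set p.1; q.1]) s].

Definition acyclic H := forall s, ~~ is_cycle H s.

Definition is_tree H := [/\ sv H != set0, connected H & acyclic H].

Definition spanning_tree H K :=
  [/\ sv K = sv H, se K \subset se H & is_tree K].

Definition tree_connected m H :=
  sv H != set0 /\
  exists T : 'I_m -> subgraph G,
    (forall i, spanning_tree H (T i)) /\
    (forall i j, i != j -> [disjoint se (T i) & se (T j)]).

(* Components are represented by their vertex sets. *)
Definition tc_component m H A : bool :=
  maxset (fun B => (B \subset sv H) && `[< tree_connected m (induced H B) >]) A.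

Definition tc_partition m H : {set {set G}} := [set A | tc_component m H A].

Definition crossing_edges H (P : {set {set G}}) :=
  #|[set e in se H | [exists A in P, exists B in P,
      [&& A != B, ends e :&: A != set0 & ends e :&: B != set0]]]|.

(* No special case is needed for the null graph, which has no component. *)
Definition Omega m H : int :=
  ((m * #|tc_partition m H|)%N%:Z - (crossing_edges H (tc_partition m H))%:Z)%R.

End Defs.

Arguments whole : clear implicits.

(* Main.v *)
Require Import Defs.
From HB Require Import structures.
From mathcomp Require Import all_boot all_order all_algebra.
From mathcomp Require Import boolp reals.
From mathcomp Require Import zify ring lra.

(* Edge sets [I] with at most [m (#|A| - 1)] edges inside every nonempty [A] are
   called sparse; they are the independent sets of a matroid and, by
   Nash-Williams, the unions of [m] disjoint forests.  A set [A] is tight if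
   equality holds.  If [I] is a maximal sparse subset of the edges of [H], then
   the [m]-tree-connected components of [H] are the maximal tight sets of [I],
   whence [Omega m H = m #|V(H)| - #|I|].

   Let [J] be a maximal sparse subset of [F], and let [I] be a largest sparse
   set containing [J] such that each [v] meets at most [h v] edges of [I \ J].
   If [I] is not large enough, an exchange argument gives a set [S] of vertices
   of full degree [h v] such that [L], obtained from [I] by removing the edges
   outside [J] that meet [S], still spans every edge of [G \ S].  The blocks of
   [L] inside [S] are components of [F], so the hypothesis on the components
   bounds [#|L|] from below in terms of [Omega m (G \ S)], which contradicts
   [Omega_bound] for [S]. *)

Set Implicit Arguments.
Unset Strict Implicit.
Unset Printing Implicit Defensive.

Import Order.TTheory GRing.Theory Num.Theory.

(** * Sparse edge sets and tight vertex sets *)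

Section Sparse.
Variable G : mgraph.
Implicit Types (I J D : {set edge G}) (A B X : {set G}) (e f : edge G) (m : nat).

Definition inside I A := [set e in I | ends e \subset A].

Definition sparse m I :=
  [forall A : {set G}, (A != set0) ==> (#|inside I A| + m <= m * #|A|)].

Definition tight m I A := (A != set0) && (#|inside I A| + m == m * #|A|).

(** For sparse [I] this union is itself tight ([tight_block]), so the blocks are the maximal tight
    sets. *)
Definition block m I (v : G) := \bigcup_(A | tight m I A && (v \in A)) A.

Lemma sparseP m I :
  reflect (forall A, A != set0 -> (#|inside I A| + m <= m * #|A|)) (sparse m I).
Proof. by apply: (iffP forallP) => h A; [apply/implyP | apply/implyP/h]. Qed.

Lemma in_inside I A e : (e \in inside I A) = (e \in I) && (ends e \subset A).
Proof. by rewrite inE. Qed.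

Lemma inside_sub I A : inside I A \subset I.
Proof. by apply/subsetP => e; rewrite in_inside => /andP[]. Qed.

Lemma insideSl I J A : I \subset J -> inside I A \subset inside J A.
Proof.
by move=> /subsetP s; apply/subsetP => e; rewrite !in_inside => /andP[/s -> ->].
Qed.

Lemma insideSr I A B : A \subset B -> inside I A \subset inside I B.
Proof.
move=> s; apply/subsetP => e; rewrite !in_inside => /andP[-> /=].
by move/subset_trans; apply.
Qed.

Lemma inside_add I A e : e \notin I -> ends e \subset A ->
  #|inside (e |: I) A| = #|inside I A|.+1.
Proof.
move=> eI eA; suff -> : inside (e |: I) A = e |: inside I A.
  by rewrite cardsU1 in_inside (negPf eI).
by apply/setP => f; rewrite !inE; case: eqP => // ->; rewrite eA.
Qed.

Lemma inside_add_out I A e : ~~ (ends e \subset A) ->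
  inside (e |: I) A = inside I A.
Proof.
move=> eA; apply/setP => f; rewrite !inE.
by case: eqP => // ->; rewrite (negPf eA) !andbF.
Qed.

Lemma inside_del I A e : e \in I -> ends e \subset A ->
  #|inside I A| = #|inside (I :\ e) A|.+1.
Proof.
move=> eI eA; rewrite -(@inside_add _ _ e) ?setD1K //.
by rewrite !inE eqxx.
Qed.

Lemma ends_neq0 e : ends e != set0.
Proof. by rewrite -card_gt0 card_ends. Qed.

Lemma ends_pair e v : v \in ends e ->
  exists2 w, w != v & ends e = [set v; w].
Proof.
move=> ve; have : #|ends e :\ v| = 1 by have := cardsD1 v (ends e); rewrite ve card_ends; lia.
case/eqP/cards1P => w ew; exists w.
  by have /setD1P[] : w \in ends e :\ v by rewrite ew inE.
by rewrite -(setD1K ve) ew.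
Qed.

(** Supermodularity: edges between [A :\: B] and [B :\: A] count only on the right. *)
Lemma card_insideUI I A B :
  (#|inside I A| + #|inside I B| <=
   #|inside I (A :|: B)| + #|inside I (A :&: B)|).
Proof.
rewrite -cardsUI leq_add // subset_leq_card //.
  by rewrite subUset !insideSr ?subsetUl ?subsetUr.
by apply/subsetP => e; rewrite !inE subsetI => /andP[/andP[-> ->] /andP[_ ->]].
Qed.

Lemma sparseS m I J : I \subset J -> sparse m J -> sparse m I.
Proof.
move=> s /sparseP h; apply/sparseP => A /h; apply: leq_trans.
by rewrite leq_add2r subset_leq_card // insideSl.
Qed.

Lemma tight_neq0 m I A : tight m I A -> A != set0.
Proof. by case/andP. Qed.

Lemma tight_card m I A : tight m I A -> (#|inside I A| + m = m * #|A|).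
Proof. by case/andP => _ /eqP. Qed.

(** Uncrossing: [m * #|A|] is modular and the edge count supermodular, so sparsity of the union and
    of the intersection leaves no room for a strict inequality. *)
Lemma tightUI m I A B : sparse m I -> tight m I A -> tight m I B ->
  A :&: B != set0 -> tight m I (A :|: B) /\ tight m I (A :&: B).
Proof.
move=> /sparseP sI tA tB AB.
have AUB : A :|: B != set0.
  by rewrite setU_eq0 negb_and (tight_neq0 tA).
have [h1 h2] := (sI _ AB, sI _ AUB).
have h3 : (m * #|A| + m * #|B| = m * #|A :|: B| + m * #|A :&: B|).
  by rewrite -!mulnDr cardsUI.
have := card_insideUI I A B.
have [h4 h5] := (tight_card tA, tight_card tB).
by rewrite /tight AB AUB /= => h6; split; apply/eqP; lia.
Qed.

Lemma tightU m I A B v : sparse m I -> tight m I A -> tight m I B ->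
  v \in A -> v \in B -> tight m I (A :|: B).
Proof.
move=> sI tA tB vA vB; apply: (tightUI sI tA tB _).1.
by apply/set0Pn; exists v; rewrite inE vA.
Qed.

Lemma inside1 I v : inside I [set v] = set0.
Proof.
apply/setP => e; rewrite !inE; apply/negbTE/negP => /andP[_ /subset_leq_card].
by rewrite cards1 card_ends.
Qed.

Lemma tight1 m I v : tight m I [set v].
Proof. by rewrite /tight inside1 cards0 cards1 muln1 add0n eqxx -card_gt0 cards1. Qed.

Lemma tightS m I J A : I \subset J -> sparse m J -> tight m I A -> tight m J A.
Proof.
move=> s /sparseP sJ tA; rewrite /tight (tight_neq0 tA) /=.
have := sJ _ (tight_neq0 tA); have := tight_card tA.
have := subset_leq_card (insideSl A s) => *; apply/eqP; lia.
Qed.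

Lemma eq_tight m I J A : #|inside I A| = #|inside J A| ->
  tight m I A = tight m J A.
Proof. by rewrite /tight => ->. Qed.

(** A set that violates sparsity once [e] is added contains both ends of [e] and had no room left
    before. *)
Lemma nsparse_tight m I e : sparse m I -> ~~ sparse m (e |: I) ->
  exists2 A, tight m I A & ends e \subset A.
Proof.
move=> /sparseP sI; rewrite negb_forall => /existsP[A].
rewrite negb_imply -ltnNge => /andP[A0 lt].
have := sI _ A0; case: (boolP (e \in I)) => eI.
  by move: lt; rewrite (setUidPr _) ?sub1set //; lia.
case: (boolP (ends e \subset A)) => eA.
  move: lt; rewrite inside_add // => ? ?; exists A => //.
  by rewrite /tight A0; apply/eqP; lia.
by move: lt; rewrite inside_add_out //; lia.
Qed.

(** Two tight sets around [e] meet, so their intersection is tight, and one of least size lies in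
    all others. The edges inside it are those that [e] can replace. *)
Lemma ex_min_tight m I B e : sparse m I -> tight m I B -> ends e \subset B ->
  exists A, [/\ tight m I A, ends e \subset A
    & forall B', tight m I B' -> ends e \subset B' -> A \subset B'].
Proof.
move=> sI tB eB.
pose P (A : {set G}) := tight m I A && (ends e \subset A).
have PB : P B by rewrite /P tB.
case: (arg_minnP (fun A : {set G} => #|A|) PB) => A /andP[tA eA] minA.
exists A; split=> // B' tB' eB'.
have eAB : ends e \subset A :&: B' by rewrite subsetI eA.
have tAB : tight m I (A :&: B').
  apply: (tightUI sI tA tB' _).2.
  by apply: contraNneq (ends_neq0 e) => e0; rewrite -subset0 -e0.
have := minA (A :&: B'); rewrite /P tAB eAB => /(_ isT) le.
have /eqP <- : A :&: B' == A by rewrite eqEcard subsetIl.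
exact: subsetIr.
Qed.

(** A tight set that gains [e] contains [A] and so loses [f]; any other set has room for one more
    edge. *)
Lemma sparse_exchange m I A e f : sparse m I -> e \notin I -> f \in I ->
  (forall B, tight m I B -> ends e \subset B -> A \subset B) ->
  ends f \subset A -> sparse m (e |: (I :\ f)).
Proof.
move=> sI eI fI minA fA; apply/sparseP => X X0.
have sX := sparseP _ _ sI _ X0.
have sX' := sparseP _ _ (sparseS (subsetDl I [set f]) sI) _ X0.
have eIf : e \notin I :\ f by rewrite inE (negPf eI) andbF.
case: (boolP (ends e \subset X)) => eX; last by rewrite inside_add_out.
rewrite inside_add //; case: (boolP (tight m I X)) => tX.
  have fX : ends f \subset X by apply: subset_trans fA (minA _ tX eX).
  by rewrite -inside_del.
have := subset_leq_card (insideSl X (subsetDl I [set f])).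
by move: tX; rewrite /tight X0 /= => /eqP; lia.
Qed.

(* If [A :\: X] were nonempty, [A] would have at most [m (#|A| - 2)] edges. *)
Lemma tight_subset m I A X v : (0 < m) -> sparse m I -> tight m I A ->
  v \in A -> v \in X ->
  (forall e w, e \in inside I A -> w \in ends e -> w \in X -> ends e \subset X) ->
  A \subset X.
Proof.
move=> m0 /sparseP sI tA vA vX clX; rewrite -setD_eq0; apply/negPn/negP => AX.
have AX' : A :&: X != set0 by apply/set0Pn; exists v; rewrite inE vA.
have [h1 h2] := (sI _ AX, sI _ AX').
have h3 : (m * #|A| = m * #|A :&: X| + m * #|A :\: X|).
  by rewrite -mulnDr cardsID.
have h4 : (#|inside I A| <= #|inside I (A :&: X)| + #|inside I (A :\: X)|).
  rewrite -cardsUI (leq_trans _ (leq_addr _ _)) // subset_leq_card //.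
  apply/subsetP => e eA; have := eA; rewrite !inE => /andP[eI sA].
  rewrite eI subsetI subsetD sA /=.
  case: (boolP [disjoint ends e & X]) => [_|]; first exact: orbT.
  rewrite -setI_eq0 => /set0Pn[w]; rewrite inE => /andP[we wX].
  by rewrite (clX _ _ eA we wX).
by have := tight_card tA; lia.
Qed.

Lemma mem_block m I v : v \in block m I v.
Proof. by apply/bigcupP; exists [set v]; rewrite ?tight1 set11. Qed.

Lemma block_max m I B v : tight m I B -> v \in B -> B \subset block m I v.
Proof. by move=> tB vB; apply: bigcup_sup; rewrite tB. Qed.

Lemma tight_block m I v : sparse m I -> tight m I (block m I v).
Proof.
move=> sI.
pose P (A : {set G}) := tight m I A && (v \in A).
have P1 : P [set v] by rewrite /P tight1 set11.
case: (arg_maxnP (fun A : {set G} => #|A|) P1) => A /andP[tA vA] maxA.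
suff -> : block m I v = A by [].
apply/eqP; rewrite eqEsubset block_max // andbT.
apply/bigcupsP => B /andP[tB vB].
have tAB := tightU sI tA tB vA vB.
have := maxA (A :|: B); rewrite /P tAB inE vA /= => /(_ isT) le.
have /eqP -> : A == A :|: B by rewrite eqEcard subsetUl.
exact: subsetUr.
Qed.

Lemma block_eq m I u v : sparse m I -> u \in block m I v ->
  block m I u = block m I v.
Proof.
move=> sI uv; have s := block_max (tight_block v sI) uv.
apply/eqP; rewrite eqEsubset s andbT.
by rewrite block_max ?tight_block // (subsetP s) ?mem_block.
Qed.

Lemma tight_meet_block m I B u v : sparse m I -> tight m I B -> u \in B ->
  u \in block m I v -> B \subset block m I v.
Proof. by move=> sI tB uB /(block_eq sI) <-; exact: block_max. Qed.

(** If [A] meets [X], the new edges inside [A] number at most those of [I] inside [A :|: X], less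
    those of [I] inside [X], plus those of [J] inside [A :&: X]; the middle term is known exactly
    because [X] is tight. *)
Lemma sparse_glue m I J X : sparse m I -> sparse m J -> tight m I X ->
  sparse m ((I :\: inside I X) :|: inside J X).
Proof.
move=> /sparseP sI /sparseP sJ tX; apply/sparseP => A A0.
set K := _ :|: _.
have eqK B : (#|inside K B| + #|inside I (B :&: X)| <=
              #|inside I B| + #|inside J (B :&: X)|).
  have -> : #|inside I B| = (#|inside I B :\: inside I X| + #|inside I (B :&: X)|).
    rewrite -(cardsID (inside I X) (inside I B)) [RHS]addnC.
    congr (#|pred_of_set _| + _).
    by apply/setP => e; rewrite !inE subsetI; case: (e \in I); rewrite /= ?andbA.
  have : inside K B \subset (inside I B :\: inside I X) :|: inside J (B :&: X).
    apply/subsetP => e; rewrite !inE subsetI.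
    case/andP=> /orP[/andP[-> ->] -> //|/andP[-> ->] ->].
    by rewrite !orbT.
  move/subset_leq_card; rewrite cardsU; lia.
have := eqK A; have [e0|AX] := eqVneq (A :&: X) set0.
  have -> : inside J (A :&: X) = set0.
    apply/setP => e; rewrite !inE e0 subset0 (negPf (ends_neq0 e)) andbF //.
  by rewrite cards0; have := sI _ A0; lia.
have AUX : A :|: X != set0 by rewrite setU_eq0 negb_and A0.
have := card_insideUI I A X; have := sI _ AUX; have := sJ _ AX.
have := tight_card tX.
have : (m * #|A| + m * #|X| = m * #|A :|: X| + m * #|A :&: X|).
  by rewrite -!mulnDr cardsUI.
lia.
Qed.

End Sparse.

(** * Decomposition into forests *)

Section ForestDecomposition.
Variables (G : mgraph) (m : nat) (D : {set edge G}).
Hypotheses (m_gt0 : 0 < m) (sparseD : sparse m D).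

(* [c e = Some i] puts [e] into the [i]-th forest, [None] leaves it out. *)
Local Notation coloring := {ffun edge G -> option 'I_m}.
Implicit Types (c : coloring) (i : 'I_m).

Let class c i := [set e | c e == Some i].
Let colored c := [set e | c e != None].
Let valid c := [forall i, sparse 1 (class c i)] && (colored c \subset D).
Let recolor c i (a b : edge G) : coloring :=
  [ffun e => if e == a then Some i else if e == b then None else c e].
Let swap : rel coloring := fun c c' => [exists i, exists a, exists b,
  [&& a \in D, c a == None, c b == Some i, c' == recolor c i a b & valid c']].

Let valid_class c i : valid c -> sparse 1 (class c i).
Proof. by case/andP => /forallP. Qed.

Let colored_recolor c i a b : c a = None -> c b = Some i ->
  colored (recolor c i a b) = a |: (colored c :\ b).
Proof.
move=> ca cb; apply/setP => e; rewrite !inE ffunE.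
by case: (e =P a) => //= _; case: (e =P b).
Qed.

Let class_recolor c i a b : c a = None -> c b = Some i ->
  class (recolor c i a b) i = a |: (class c i :\ b).
Proof.
move=> ca cb; apply/setP => e; rewrite !inE ffunE.
by case: (e =P a) => /= [_|_]; [exact: eqxx | case: (e =P b)].
Qed.

Let class_recolor_neq c i j a b : c a = None -> c b = Some i -> j != i ->
  class (recolor c i a b) j = class c j.
Proof.
move=> ca cb ji; apply/setP => e; rewrite !inE ffunE.
have [->|_] := eqVneq e a; first by rewrite ca (inj_eq (@Some_inj _)) [i == j]eq_sym (negPf ji).
have [->|//] := eqVneq e b.
by rewrite cb (inj_eq (@Some_inj _)) [i == j]eq_sym (negPf ji).
Qed.

Section Reachable.
Variable c0 : coloring.
Hypothesis valid_c0 : valid c0.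
Hypothesis max_c0 : forall c, valid c -> #|colored c| <= #|colored c0|.

(** The edges that a chain of exchanges from [c0] can set free. If [c0] misses an edge of [D], the
    forests restricted to [K] turn out to share a component that is too dense for [D]. *)
Let K := [set a in D | [exists c, connect swap c0 c && (c a == None)]].

Let swap_valid c c' : swap c c' -> valid c' /\ #|colored c'| = #|colored c|.
Proof.
case/existsP => i /existsP[a /existsP[b /and5P[aD /eqP ca /eqP cb /eqP ec v]]].
split=> //; rewrite ec colored_recolor // cardsU1 !inE ca eqxx andbF /=.
by rewrite [RHS](cardsD1 b) inE cb.
Qed.

Let reach_valid c : connect swap c0 c -> valid c /\ #|colored c| = #|colored c0|.
Proof.
case/connectP => p; elim/last_ind: p c => [|p c1 IH] c /=; first by move=> _ ->.
rewrite rcons_path last_rcons => /andP[/IH IHp st] ->.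
by have [v <-] := IHp _ erefl; exact: swap_valid.
Qed.

(* Every edge of the circuit closed by an uncoloured edge [a] in a forest
   could be swapped out for [a], so the whole circuit lies in [K]. *)
Let circuit c i a : connect swap c0 c -> a \in D -> c a = None ->
  exists A, [/\ tight 1 (class c i :&: K) A, tight 1 (class c i) A,
    ends a \subset A
    & forall B, tight 1 (class c i) B -> ends a \subset B -> A \subset B].
Proof.
move=> rc aD ca; have [vc mc] := reach_valid rc; have sc := valid_class i vc.
have aN : a \notin class c i by rewrite inE ca.
(* If [a] could simply receive colour [i], the colouring would exceed [max_c0]. *)
have [B tB aB] : exists2 B, tight 1 (class c i) B & ends a \subset B.
  apply: nsparse_tight => //; apply/negP => sa.
  pose c' : coloring := [ffun e => if e == a then Some i else c e].
  have cl' : colored c' = a |: colored c.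
    by apply/setP => e; rewrite !inE ffunE; case: (e =P a).
  have vc' : valid c'.
    apply/andP; split; last first.
      by rewrite cl' subUset sub1set aD; case/andP: vc.
    apply/forallP => j; have [->|ji] := eqVneq j i.
      apply: sparseS sa; apply/subsetP => e; rewrite !inE ffunE.
      by case: (e =P a).
    apply: sparseS (valid_class j vc); apply/subsetP => e; rewrite !inE ffunE.
    by case: (e =P a) => // _; rewrite (inj_eq (@Some_inj _)) [i == j]eq_sym (negPf ji).
  by have := max_c0 vc'; rewrite cl' cardsU1 inE ca eqxx /= mc ltnn.
have [A [tA aA minA]] := ex_min_tight sc tB aB.
exists A; split=> //.
rewrite -(@eq_tight _ _ (class c i)) //; congr #|pred_of_set _|.
apply/setP => b; rewrite !in_inside in_setI.
case: (boolP (b \in class c i)) => //= bi.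
case: (boolP (ends b \subset A)) => [bA|]; last by rewrite andbF.
rewrite andbT; apply/esym.
have cb : c b = Some i by apply/eqP; rewrite inE in bi.
rewrite inE (subsetP (proj2 (andP vc))) ?inE ?cb //=.
apply/existsP; exists (recolor c i a b); apply/andP; split; last first.
  by rewrite ffunE; case: (b =P a) => [eba|_]; [move: cb; rewrite eba ca | rewrite eqxx].
apply: (connect_trans rc); apply: connect1.
apply/existsP; exists i; apply/existsP; exists a; apply/existsP; exists b.
rewrite aD ca cb !eqxx /=; apply/andP; split.
  apply/forallP => j; have [->|ji] := eqVneq j i.
    by rewrite class_recolor //; exact: sparse_exchange sc aN bi minA bA.
  by rewrite class_recolor_neq // valid_class.
rewrite colored_recolor // subUset sub1set aD /=.
by apply: subset_trans (subsetDl _ _) _; case/andP: vc.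
Qed.

(** The swap stays inside the circuit of [a], whose vertex set is tight before and after; adjoining
    it to a tight set that uses [a] undoes the effect of the swap. *)
Let tight_swap c c' i T : connect swap c0 c -> swap c c' ->
  tight 1 (class c' i :&: K) T ->
  exists2 T' : {set G}, T \subset T' & tight 1 (class c i :&: K) T'.
Proof.
move=> rc st; have rc' := connect_trans rc (connect1 st).
have [vc _] := reach_valid rc; have [vc' _] := reach_valid rc'.
case/existsP: st => j /existsP[a /existsP[b /and5P[aD /eqP ca /eqP cb /eqP ec _]]].
have [->|ij] := eqVneq i j; last by rewrite ec class_recolor_neq //; exists T.
have [A [tKA tA aA _]] := circuit j rc aD ca.
have sK : sparse 1 (class c j :&: K) by apply: sparseS (valid_class j vc); exact: subsetIl.
have sK' : sparse 1 (class c' j :&: K) by apply: sparseS (valid_class j vc'); exact: subsetIl.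
have eb : b \in class c j by rewrite inE cb.
have ea : a \notin class c j :\ b by rewrite !inE ca andbF.
have aK : a \in K by rewrite inE aD; apply/existsP; exists c; rewrite rc ca /=.
have bK : b \in K.
  rewrite inE (subsetP (proj2 (andP vc))) ?inE ?cb //=.
  apply/existsP; exists c'; rewrite rc' ec ffunE eqxx.
  by case: (b =P a) => [eba|//]; move: cb; rewrite eba ca.
have ecl : class c' j :&: K = a |: ((class c j :&: K) :\ b).
  rewrite ec class_recolor //; apply/setP => e.
  rewrite !(in_setI, in_setU1, in_setD1).
  have [->|_] /= := eqVneq e a; first exact: aK.
  by rewrite andbA.
(* If [b] were not inside [A], the new class would have one edge too many there. *)
have bA : ends b \subset A.
  apply/negPn/negP => nbA.
  have := sparseP _ _ (valid_class j vc') A (tight_neq0 tA).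
  rewrite ec class_recolor // inside_add //.
  suff -> : inside (class c j :\ b) A = inside (class c j) A.
    by rewrite addSn (tight_card tA) ltnn.
  apply/setP => e; rewrite !in_inside in_setD1; case: (e =P b) => // ->.
  by rewrite (negPf nbA) !andbF.
have swapE (X : {set G}) : ends a \subset X -> ends b \subset X ->
    tight 1 (class c' j :&: K) X = tight 1 (class c j :&: K) X.
  move=> aX bX; apply: eq_tight; rewrite ecl inside_add //; last first.
    by rewrite !inE ca andbF.
  by rewrite [RHS](@inside_del _ _ _ b) // inE eb.
move=> tT; case: (boolP (ends a \subset T)) => aT.
  have /set0Pn[v va] := ends_neq0 a.
  exists (T :|: A); first exact: subsetUl.
  rewrite -swapE; last 2 first.
  - exact: subset_trans aA (subsetUr _ _).
  - exact: subset_trans bA (subsetUr _ _).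
  apply: (@tightU _ _ _ _ _ v) => //; rewrite ?swapE //.
    exact: (subsetP aT).
  exact: (subsetP aA).
exists T => //; move: tT; rewrite ecl.
rewrite (@eq_tight _ _ _ (class c j :&: K :\ b)); last by rewrite inside_add_out.
exact: tightS (subsetDl _ _) _.
Qed.

Let tight_reach c i T : connect swap c0 c -> tight 1 (class c i :&: K) T ->
  exists2 T' : {set G}, T \subset T' & tight 1 (class c0 i :&: K) T'.
Proof.
case/connectP => p; elim/last_ind: p c T => [|p c1 IH] c T /=.
  by move=> _ -> tT; exists T.
rewrite rcons_path last_rcons => /andP[pp st] -> tT.
have rc : connect swap c0 (last c0 p) by apply/connectP; exists p.
have [T1 s1 t1] := tight_swap rc st tT.
have [T2 s2 t2] := IH _ _ pp erefl t1.
by exists T2 => //; exact: subset_trans s1 s2.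
Qed.

Let tight_K i x : x \in K ->
  exists2 T : {set G}, ends x \subset T & tight 1 (class c0 i :&: K) T.
Proof.
rewrite inE => /andP[xD /existsP[c /andP[rc /eqP cx]]].
have [A [tA _ xA _]] := circuit i rc xD cx.
by have [T AT tT] := tight_reach rc tA; exists T => //; exact: subset_trans xA AT.
Qed.

(** For an uncoloured [e], all [m] forests restricted to [K] have the same component [U] at an end
    of [e]. It holds at least [m (#|U| - 1)] coloured edges and also [e], more than sparsity of [D]
    permits. *)
Lemma max_coloring_full : colored c0 = D.
Proof.
have cD := proj2 (andP valid_c0).
apply/eqP; rewrite eqEsubset cD; apply/subsetP => e eD.
rewrite inE; apply/negP => /eqP ce.
have eK : e \in K by rewrite inE eD; apply/existsP; exists c0; rewrite connect0 ce /=.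
have sK i : sparse 1 (class c0 i :&: K).
  by apply: sparseS (valid_class i valid_c0); exact: subsetIl.
have /set0Pn[v ve] := ends_neq0 e.
pose U i := block 1 (class c0 i :&: K) v.
have tU i : tight 1 (class c0 i :&: K) (U i) by exact: tight_block.
have closed i x w : x \in K -> w \in ends x -> w \in U i -> ends x \subset U i.
  move=> xK wx wU; have [T xT tT] := tight_K i xK.
  by apply: (subset_trans xT); apply: tight_meet_block wU => //; exact: (subsetP xT).
(* [U j] is closed under the edges of [K], and the tight set [U i] is connected by such edges. *)
have UU i j : U i \subset U j.
  apply: (@tight_subset _ 1 (class c0 i :&: K) _ _ v) => //; try exact: mem_block.
  move=> x w; rewrite in_inside in_setI => /andP[/andP[_ xK] _].
  exact: closed.
have [i0 _] : exists i0 : 'I_m, true by exists (Ordinal m_gt0).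
have cardU i : #|inside (class c0 i) (U i0)| >= #|U i0| - 1.
  have -> : U i0 = U i by apply/eqP; rewrite eqEsubset !UU.
  have := tight_card (tU i); have := subset_leq_card (insideSl (U i) (subsetIl (class c0 i) K)).
  clear; lia.
have eU : ends e \subset U i0 by apply: closed ve _ => //; exact: mem_block.
have sumU : \sum_i #|inside (class c0 i) (U i0)| <= #|inside (D :\ e) (U i0)|.
  under eq_bigr => i _ do rewrite -sum1_card big_mkcond.
  rewrite exchange_big -sum1_card [X in _ <= X]big_mkcond leq_sum // => x _ /=.
  case: (boolP (x \in inside (D :\ e) (U i0))) => [_|xN]; last first.
    rewrite big1 // => i _; rewrite in_inside; case: ifP => // /andP[xi xU].
    move: xN; rewrite in_inside xU andbT in_setD1.
    have -> : x \in D by apply: (subsetP cD); move: xi; rewrite !inE => /eqP ->.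
    by move: xi; rewrite inE; case: (x =P e) => // ->; rewrite ce.
  case cx: (c0 x) => [i|]; last by rewrite big1 // => i _; rewrite !inE cx.
  rewrite (bigD1 i) //= big1 ?addn0; first by case: ifP.
  by move=> j ji; rewrite !inE cx (inj_eq (@Some_inj _)) [i == j]eq_sym (negPf ji).
have := sparseP _ _ sparseD (U i0) (tight_neq0 (tU i0)).
rewrite (inside_del eD eU).
have : \sum_(i < m) (#|U i0| - 1) <= \sum_i #|inside (class c0 i) (U i0)|.
  by apply: leq_sum.
rewrite sum_nat_const card_ord mulnBr muln1.
have : 0 < #|U i0| by rewrite card_gt0 (tight_neq0 (tU i0)).
by move: sumU; clear; nia.
Qed.

End Reachable.

(* Nash-Williams' arboricity theorem; the proof is that of Diestel, Graph
   Theory, Section 2.4. *)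
Theorem forest_decomposition : exists T : 'I_m -> {set edge G},
  [/\ forall i, sparse 1 (T i), forall i j, i != j -> [disjoint T i & T j]
    & \bigcup_i T i = D].
Proof.
have v0 : valid [ffun => None].
  apply/andP; split; last by apply/subsetP => e; rewrite !inE ffunE.
  apply/forallP => i; apply/sparseP => A A0.
  rewrite (_ : inside _ _ = set0) ?cards0 ?mul1n ?card_gt0 //.
  by apply/setP => e; rewrite !inE ffunE.
case: (arg_maxnP (fun c => #|colored c|) v0) => c vc maxc.
exists (class c); split.
- by move=> i; exact: valid_class.
- move=> i j ij; rewrite -setI_eq0; apply/eqP/setP => e; rewrite !inE.
  by apply/negbTE/negP => /andP[/eqP -> /eqP[]] /eqP; rewrite (negPf ij).
rewrite -(max_coloring_full vc maxc); apply/setP => e; rewrite inE.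
apply/bigcupP/idP => [[i _]|]; first by rewrite inE => /eqP ->.
by case ce: (c e) => [i|//] _; exists i; rewrite ?inE ?ce.
Qed.

End ForestDecomposition.

(** * Trees *)


Lemma card_disjoint_bigcup (I T : finType) (F : I -> {set T}) :
  (forall i j, i != j -> [disjoint F i & F j]) ->
  #|\bigcup_i F i| = \sum_i #|F i|.
Proof.
move=> dF; rewrite -sum1_card partition_disjoint_bigcup //.
by apply: eq_bigr => i _; rewrite sum1_card.
Qed.

Section Trees.
Variable G : mgraph.
Implicit Types (I : {set edge G}) (A X : {set G}) (T H : subgraph G).

Definition eadj I : rel G := fun x y => [exists e in I, ends e == [set x; y]].

Lemma connect_closed I x e v : e \in I -> v \in ends e ->
  connect (eadj I) x v -> forall w, w \in ends e -> connect (eadj I) x w.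
Proof.
move=> eI ve xv w we; have [<-//|wv] := eqVneq v w.
apply: (connect_trans xv); apply: connect1; apply/exists_inP; exists e => //.
have [u uv eu] := ends_pair ve.
by move: we; rewrite eu !inE eq_sym (negPf wv) /= => /eqP ->.
Qed.

Section BridgeCycle.
Variables (I : {set edge G}) (e : edge G).

Let pick_edge (x y : G) := odflt e [pick f in I | ends f == [set x; y]].

Let pick_edgeP x y : eadj I x y ->
  pick_edge x y \in I /\ ends (pick_edge x y) = [set x; y].
Proof.
rewrite /pick_edge; case: pickP => [f /andP[fI /eqP ef] //|no].
by case/exists_inP => f fI ef; move: (no f); rewrite fI ef.
Qed.

(** Each vertex is paired with the edge to its successor, as in [is_cycle]; [e] leaves the last
    vertex and is to close the cycle. *)
Fixpoint lift_path (x : G) (p : seq G) : seq (G * edge G) :=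
  if p is y :: p' then (x, pick_edge x y) :: lift_path y p' else [:: (x, e)].

Lemma lift_path_vertices x p : unzip1 (lift_path x p) = x :: p.
Proof. by elim: p x => //= y p IH x; rewrite IH. Qed.

Lemma lift_path_edges x p : path (eadj I) x p ->
  {in unzip2 (lift_path x p), forall f,
    f = e \/ f \in I /\ ends f \subset x :: p}.
Proof.
elim: p x => [|y p IH] x /= => [_ f|/andP[xy /IH{}IH] f].
  by rewrite inE => /eqP; left.
have [fI ef] := pick_edgeP xy.
rewrite inE => /orP[/eqP ->|/IH [->|[fI' /subsetP s]]]; [right|by left|right].
  split=> //; rewrite ef; apply/subsetP => z; rewrite !inE.
  by case/orP => -> //; rewrite orbT.
by split=> //; apply/subsetP => z /s; rewrite !inE => ->; rewrite orbT.
Qed.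

(** The edge leaving [x] contains [x], while every later edge of [I] lies in the rest of the simple
    path. *)
Lemma lift_path_uniq x p : e \notin I -> uniq (x :: p) ->
  path (eadj I) x p -> uniq (unzip2 (lift_path x p)).
Proof.
move=> eI; elim: p x => // y p IH x /= /andP[xp up] /andP[xy pp].
rewrite IH // andbT; apply/negP => /(lift_path_edges pp).
have [fI ef] := pick_edgeP xy.
case=> [fe|[_ /subsetP/(_ x)]]; first by rewrite fe in fI; rewrite fI in eI.
by rewrite ef !inE eqxx /= => /(_ isT); move: xp; rewrite inE => /negPf ->.
Qed.

(** [q] stands for the first entry repeated at the end, which turns [sorted] into [cycle]. *)
Lemma lift_path_sorted x p q : path (eadj I) x p ->
  ends e = [set last x p; q.1] ->
  sorted (fun p q => ends p.2 == [set p.1; q.1]) (rcons (lift_path x p) q).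
Proof.
elim: p x => [|y p IH] x /=; first by move=> _ ->; rewrite eqxx.
case/andP => xy pp ee; have := IH y pp ee; have [_ ef] := pick_edgeP xy.
by case: (p) => [|z p'] /= ->; rewrite ef eqxx.
Qed.

End BridgeCycle.

Lemma acyclic_bridge T e x y : acyclic T -> e \in se T -> ends e = [set x; y] ->
  ~~ connect (eadj (se T :\ e)) x y.
Proof.
move=> acT eT ee; apply/negP => /connectP[p0].
case/shortenP => p pp up _ ey.
have eI : e \notin se T :\ e by rewrite !inE eqxx.
apply/negP: (acT (lift_path (se T :\ e) e x p)); apply/negPn.
rewrite /is_cycle lift_path_vertices up lift_path_uniq //=.
have -> /= : lift_path (se T :\ e) e x p != [::] by case: (p).
apply/andP; split.
  apply/allP => q qs; have : q.2 \in unzip2 (lift_path (se T :\ e) e x p) by exact: map_f.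
  by case/(lift_path_edges pp) => [->//|[]]; rewrite in_setD1 => /andP[].
have := @lift_path_sorted (se T :\ e) e x p (head (x, e) (lift_path (se T :\ e) e x p)) pp.
rewrite -ey; case: (p) => [|z p'] /=; rewrite ee setUC; exact.
Qed.

(** Induction on [#|A|]. Deleting an edge [e] inside [A] separates its ends by [acyclic_bridge], so
    the component [X] of one end cuts [A] into two nonempty parts that only [e] joins. *)
Lemma acyclic_sparse T : acyclic T -> sparse 1 (se T).
Proof.
move=> acT; apply/sparseP => A; have [n] := ubnP #|A|.
elim: n A => // n IH A; rewrite ltnS => leA A0; rewrite mul1n.
have [i0|/set0Pn[e eA]] := eqVneq (inside (se T) A) set0.
  by rewrite i0 cards0 card_gt0.
have [eT sA] : e \in se T /\ ends e \subset A by apply/andP; rewrite -in_inside.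
have /set0Pn[x xe] := ends_neq0 e; have [y yx ee] := ends_pair xe.
have nxy := acyclic_bridge acT eT ee.
pose X := [set z | connect (eadj (se T :\ e)) x z].
have xA : x \in A by exact: (subsetP sA).
have yA : y \in A by apply: (subsetP sA); rewrite ee !inE eqxx orbT.
have AX0 : A :&: X != set0 by apply/set0Pn; exists x; rewrite !inE xA connect0.
have AD0 : A :\: X != set0 by apply/set0Pn; exists y; rewrite !inE yA nxy.
have cA := cardsID X A.
have [c1 c2] : 0 < #|A :&: X| /\ 0 < #|A :\: X| by rewrite !card_gt0.
have h1 := IH (A :&: X); have h2 := IH (A :\: X).
have sub : inside (se T) A \subset
    e |: (inside (se T) (A :&: X) :|: inside (se T) (A :\: X)).
  apply/subsetP => f; rewrite in_setU1 in_setU !in_inside => /andP[fT fA].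
  have [//|fe] := eqVneq f e; rewrite fT subsetI subsetD fA /=.
  case: (boolP [disjoint ends f & X]) => [_|]; first exact: orbT.
  rewrite -setI_eq0 => /set0Pn[w]; rewrite !inE => /andP[wf xw].
  apply/orP; left; apply/subsetP => z zf; rewrite inE.
  by apply: (connect_closed _ wf xw zf); rewrite !inE fe.
have := subset_leq_card sub; rewrite cardsU1 cardsU.
move: h1 h2; rewrite !mul1n; lia.
Qed.

(** A tight set stays tight when a neighbour is added along with the edge leading to it. So the
    block of [v] is all of [sv T], where tightness is the claimed equation. *)
Lemma connected_card T : sv T != set0 -> connected T -> sparse 1 (se T) ->
  #|se T| + 1 = #|sv T|.
Proof.
move=> /set0Pn[v vT] cT sT.
have sb := tight_block v sT.
suff eb : block 1 (se T) v = sv T.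
  have := tight_card sb; rewrite mul1n eb => <-; congr (#|pred_of_set _| + _).
  by apply/setP => e; rewrite in_inside; case: (boolP (e \in _)) => // /se_sub ->.
apply/eqP; rewrite eqEsubset; apply/andP; split.
  apply: (tight_subset (ltn0Sn 0) sT sb (mem_block _ _ _) vT).
  by move=> e w; rewrite in_inside => /andP[/se_sub].
apply/subsetP => x xT; have /connectP[p pp ->] := cT v x vT xT.
elim/last_ind: p pp => [_|p y IH]; first exact: mem_block.
rewrite rcons_path last_rcons => /andP[/IH]; set u := last v p => ub.
case/exists_inP => e eT /eqP ee; apply/negPn/negP => yb.
suff /block_max/(_ (_ : v \in _))/subsetP/(_ y) :
    tight 1 (se T) (y |: block 1 (se T) v).
  by rewrite !inE eqxx mem_block orbT => /(_ isT isT); rewrite (negPf yb).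
have y0 : y |: block 1 (se T) v != set0 by apply/set0Pn; exists y; exact: setU11.
rewrite /tight y0 eqn_leq (sparseP _ _ sT) //=.
rewrite cardsU1 yb mul1n add1n -addn1 leq_add2r.
have := tight_card sb; rewrite mul1n => <-.
have -> : #|inside (se T) (block 1 (se T) v)| + 1 = #|e |: inside (se T) (block 1 (se T) v)|.
  rewrite cardsU1 in_inside ee subUset !sub1set (negPf yb) !andbF /= addnC //.
apply: subset_leq_card; rewrite subUset sub1set in_inside eT ee.
rewrite insideSr ?subsetUr // subUset !sub1set !inE eqxx ub orbT //.
Qed.

(** A tight set is connected through its own edges by [tight_subset], and a cycle has as many edges
    as vertices, one more than sparsity permits. *)
Lemma sparse_is_tree T : sparse 1 (se T) -> #|se T| + 1 = #|sv T| -> is_tree T.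
Proof.
move=> sT cT; have T0 : sv T != set0 by rewrite -card_gt0 -cT addn1.
have tT : tight 1 (se T) (sv T).
  rewrite /tight T0 mul1n -cT; apply/eqP; congr (#|pred_of_set _| + _).
  by apply/setP => e; rewrite in_inside; case: (boolP (e \in _)) => // /se_sub ->.
split=> //.
  move=> x y xT yT; pose X := [set z | connect (adj T) x z].
  suff /subsetP/(_ _ yT) : sv T \subset X by rewrite inE.
  apply: (@tight_subset _ 1 (se T) _ _ x) => //; first by rewrite inE connect0.
  move=> e w; rewrite in_inside !inE => /andP[eT _] we xw.
  by apply/subsetP => z ze; rewrite inE; exact: connect_closed we xw _ ze.
move=> s; apply/negP => /and5P[s0 u1 u2 /allP sE cs].
pose A := [set x in unzip1 s]; pose E := [set f in unzip2 s].
have cA : #|A| = size s by rewrite cardsE (card_uniqP u1) size_map.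
have cE : #|E| = size s by rewrite cardsE (card_uniqP u2) size_map.
have A0 : A != set0 by rewrite -card_gt0 cA lt0n size_eq0.
have : E \subset inside (se T) A.
  apply/subsetP => f; rewrite inE => /mapP[q qs ->]; rewrite in_inside sE //=.
  have /eqP -> := next_cycle cs qs.
  by rewrite subUset !sub1set !inE !map_f // mem_next.
move/subset_leq_card; have := sparseP _ _ sT A A0; rewrite cA cE; lia.
Qed.

(** From left to right, the [m (#|A| - 1)] edges inside [A] split into [m] forests of at most
    [#|A| - 1] edges, so each of them is a spanning tree. From right to left, the union of the trees
    is the witness. *)
Lemma tree_connected_tightP m H A : 0 < m -> A \subset sv H ->
  (exists I, [/\ I \subset se H, sparse m I & tight m I A]) <->
  tree_connected m (induced H A).
Proof.
move=> m0 AH; have svA : sv (induced H A) = A by apply/setIidPr.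
split=> [[I [IH sI tI]]|[A0 [T [sT dT]]]].
  split; first by rewrite svA (tight_neq0 tI).
  have sIA : sparse m (inside I A) by apply: sparseS sI; exact: inside_sub.
  have [F [sF dF eF]] := forest_decomposition m0 sIA.
  have FI i : F i \subset inside I A by rewrite -eF bigcup_sup.
  have FA i e : e \in F i -> ends e \subset A.
    by move/(subsetP (FI i)); rewrite in_inside => /andP[].
  have cF i : #|F i| + 1 = #|A|.
    have leF j : #|F j| <= #|A| - 1.
      have := sparseP _ _ (sF j) A (tight_neq0 tI).
      suff -> : inside (F j) A = F j by clear; lia.
      apply/setP => e; rewrite in_inside; case: (boolP (e \in _)) => //.
      exact: FA.
    have A1 : 0 < #|A| by rewrite card_gt0 (tight_neq0 tI).
    have := tight_card tI; rewrite -eF.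
    have cI : \sum_j #|F j| = #|inside I A| by rewrite -eF card_disjoint_bigcup.
    have : \sum_(j | j != i) #|F j| <= (m - 1) * (#|A| - 1).
      have -> : m - 1 = #|predC1 i| by rewrite cardC1 card_ord subn1.
      by rewrite -sum_nat_const leq_sum.
    have := tight_card tI; rewrite -cI (bigD1 i) //=; have := leF i.
    clear -m0 A1; nia.
  exists (fun i => @Subgraph G A (F i) (FA i)); split=> //.
  move=> i; split.
  - by rewrite svA.
  - apply: (subset_trans (FI i)); apply/subsetP => e.
    by rewrite in_inside inE => /andP[/(subsetP IH) -> ->].
  - by apply: sparse_is_tree; rewrite /= ?cF.
have tT i : sparse 1 (se (T i)) /\ #|se (T i)| + 1 = #|A|.
  have [svT _ [T0 cT aT]] := sT i; have s1 := acyclic_sparse aT.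
  by rewrite (connected_card T0 cT s1) svT svA.
have EA i e : e \in se (T i) -> ends e \subset A.
  by move/se_sub; have [-> _ _] := sT i; rewrite svA.
have cardI X : #|inside (\bigcup_i se (T i)) X| = \sum_i #|inside (se (T i)) X|.
  rewrite -card_disjoint_bigcup => [|i j ij].
    congr #|pred_of_set _|; apply/setP => e; rewrite in_inside.
    apply/andP/bigcupP => [[/bigcupP[i _ ei] eX]|[i _]].
      by exists i => //; rewrite in_inside ei.
    by rewrite in_inside => /andP[ei ->]; split=> //; apply/bigcupP; exists i.
  apply: disjointWl (inside_sub _ _) _; apply: disjointWr (inside_sub _ _) _.
  exact: dT.
exists (\bigcup_i se (T i)); split.
- apply/bigcupsP => i _; have [_ s _] := sT i.
  by apply: (subset_trans s); apply/subsetP => e; rewrite inE => /andP[].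
- apply/sparseP => X X0; rewrite cardI.
  have : \sum_(i < m) (#|inside (se (T i)) X| + 1) <= \sum_(i < m) #|X|.
    apply: leq_sum => i _; have [s1 _] := tT i.
    by have := sparseP _ _ s1 X X0; rewrite mul1n.
  by rewrite big_split /= !sum_nat_const card_ord muln1.
- have A0' : A != set0 by rewrite -svA.
  rewrite /tight A0' cardI /=.
  have : \sum_(i < m) (#|inside (se (T i)) A| + 1) = \sum_(i < m) #|A|.
    apply: eq_bigr => i _; have [_ <-] := tT i; congr (#|pred_of_set _| + _).
    apply/setP => e; rewrite in_inside; case: (boolP (e \in _)) => //.
    exact: EA.
  by rewrite big_split /= !sum_nat_const card_ord muln1 => ->.
Qed.

End Trees.

(** * Components and Omega *)


Section Bases.
Variable G : mgraph.
Implicit Types (I J D R : {set edge G}) (A B X S : {set G}) (H : subgraph G).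
Implicit Types (P : {set {set G}}) (m : nat).

(** A maximal sparse subset of [D], with maximality in the form that [nsparse_tight] gives it. *)
Definition base m D I := [/\ I \subset D, sparse m I &
  forall e, e \in D -> e \notin I -> exists2 A, tight m I A & ends e \subset A].

Definition crossing I P := [set e in I | ~~ [exists B in P, ends e \subset B]].

Definition blocks m I A := [set block m I v | v in A].

Lemma base_extend m D J : J \subset D -> sparse m J ->
  exists2 I, base m D I & J \subset I.
Proof.
move=> JD sJ; have PJ : (J \subset D) && sparse m J by rewrite JD.
have [I /maxsetP[/andP[ID sI] maxI] JI] :=
  @maxset_exists _ (fun I => (I \subset D) && sparse m I) J PJ.
exists I => //; split=> // e eD eI; apply: nsparse_tight => //.
apply/negP => sIe; move: eI; rewrite -(maxI (e |: I)) ?setU11 ?subsetUr //.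
by rewrite subUset sub1set eD ID.
Qed.

Lemma base_block m D I e v : base m D I -> e \in D -> e \notin I ->
  v \in ends e -> ends e \subset block m I v.
Proof.
move=> [_ sI bI] eD eI ve; have [A tA eA] := bI e eD eI.
by apply: (subset_trans eA); apply: block_max => //; exact: (subsetP eA).
Qed.

Lemma block_partition m I A : sparse m I ->
  (forall v, v \in A -> block m I v \subset A) -> partition (blocks m I A) A.
Proof.
move=> sI closed; apply/and3P; split.
- apply/eqP/setP => v; apply/bigcupP/idP => [[B /imsetP[u uA ->] vu]|vA].
    exact: (subsetP (closed u uA)).
  by exists (block m I v); [exact: imset_f | exact: mem_block].
- apply/trivIsetP => _ _ /imsetP[u uA ->] /imsetP[w wA ->]; apply: contraR.
  rewrite -setI_eq0 => /set0Pn[v]; rewrite inE => /andP[vu vw].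
  by rewrite -(block_eq sI vu) -(block_eq sI vw).
apply/imsetP => -[v vA e0]; have := mem_block m I v.
by rewrite -e0 inE.
Qed.

Lemma trivIset_inside P e B B' : trivIset P -> B \in P -> B' \in P ->
  ends e \subset B -> ends e \subset B' -> B = B'.
Proof.
move=> /trivIsetP tP BP BP' eB eB'; apply/eqP/negPn/negP => /(tP _ _ BP BP').
rewrite -setI_eq0 => /eqP d; have /set0Pn[v ve] := ends_neq0 e.
by have := in_set0 v; rewrite -d inE (subsetP eB) ?(subsetP eB').
Qed.

Lemma card_crossing I P : trivIset P ->
  #|I| = \sum_(B in P) #|inside I B| + #|crossing I P|.
Proof.
move=> tP; rewrite -(cardsID (crossing I P) I) addnC; congr (_ + _); last first.
  by rewrite (setIidPr _) //; apply/subsetP => e; rewrite inE => /andP[].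
under [RHS]eq_bigr => B _ do rewrite -sum1_card big_mkcond.
rewrite exchange_big -sum1_card big_mkcond; apply: eq_bigr => e _ /=.
rewrite !inE; case: (boolP (e \in I)) => eI; last first.
  by rewrite andbF big1 // => B _; rewrite in_inside (negPf eI).
rewrite /= negbK andbT; case: ifPn => [/existsP[B /andP[BP eB]]|no].
  rewrite (bigD1 B) //= in_inside eI eB big1 // => B' /andP[BP' neq].
  rewrite in_inside eI /=; case: ifP => // eB'.
  by rewrite (trivIset_inside tP BP BP' eB eB') eqxx in neq.
rewrite big1 // => B BP; rewrite in_inside eI /=; case: ifP => // eB.
by move/negP: no; case; apply/existsP; exists B; rewrite BP.
Qed.

Lemma sum_tight m I P A : partition P A -> {in P, forall B, tight m I B} ->
  \sum_(B in P) #|inside I B| + m * #|P| = m * #|A|.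
Proof.
move=> pP tP; rewrite (card_partition pP) big_distrr /= mulnC -sum_nat_const.
by rewrite -big_split; apply: eq_bigr => B /tP /tight_card.
Qed.

Lemma card_partition_setI P X A : partition P X -> A \subset X ->
  #|A| = \sum_(B in P) #|A :&: B|.
Proof.
case/and3P => /eqP eX tP _ AX.
have cE (B : {set G}) : #|A :&: B| = \sum_(x in B) (x \in A).
  rewrite -sum1_card big_mkcond [RHS]big_mkcond; apply: eq_bigr => x _.
  by rewrite inE; case: (x \in A); case: (x \in B).
under eq_bigr => B _ do rewrite cE.
by rewrite -[RHS](@big_trivIset _ _ _ _ P (fun x => nat_of_bool (x \in A)) tP) eX -cE (setIidPl _).
Qed.

Section Components.
Variables (m : nat) (H : subgraph G) (I : {set edge G}).
Hypotheses (m_gt0 : 0 < m) (bI : base m (se H) I).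

Lemma base_sparse : sparse m I.
Proof. by case: bI. Qed.

Lemma tight_sv A v : tight m I A -> v \in A -> v \in sv H -> A \subset sv H.
Proof.
move=> tA vA vH; apply: (tight_subset m_gt0 base_sparse tA vA vH) => e w.
rewrite in_inside => /andP[eI _] _ _; apply: se_sub.
by have [/subsetP s _ _] := bI; exact: s.
Qed.

Lemma block_sv v : v \in sv H -> block m I v \subset sv H.
Proof. by apply: tight_sv; [exact: tight_block base_sparse | exact: mem_block]. Qed.

Lemma blocks_partition : partition (blocks m I (sv H)) (sv H).
Proof. exact: block_partition base_sparse block_sv. Qed.

(* If [A] met [k > 1] blocks of [I], a witness of tree-connectivity of [A] would
   have [m (k - 1)] edges between them; these lie in [I] by maximality, so the
   union of the [k] blocks would be tight. *)
Lemma tree_connected_block A v : A \subset sv H ->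
  tree_connected m (induced H A) -> v \in A -> A \subset block m I v.
Proof.
move=> AH /(tree_connected_tightP m_gt0 AH)[J [JH sJ tJ]] vA.
pose U := \bigcup_(w in A) block m I w.
have AU : A \subset U.
  by apply/subsetP => w wA; apply/bigcupP; exists w; rewrite ?mem_block.
have closedU w : w \in U -> block m I w \subset U.
  case/bigcupP => u uA /(block_eq base_sparse) ->; exact: bigcup_sup.
pose P := blocks m I U; have pP : partition P U by exact: block_partition base_sparse closedU.
have [_ tP _] := and3P pP.
have PU B : B \in P -> B \subset U by case/imsetP => w /closedU s ->.
have PA B : B \in P -> A :&: B != set0.
  case/imsetP => w /bigcupP[u uA wu] ->; rewrite (block_eq base_sparse wu).
  by apply/set0Pn; exists u; rewrite inE uA mem_block.
have tightP : {in P, forall B, tight m I B}.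
  by move=> _ /imsetP[w _ ->]; exact: tight_block base_sparse.
have sub : crossing (inside J A) P \subset crossing (inside I U) P.
  apply/subsetP => e; rewrite !inE => /andP[/andP[eJ eA] eP].
  rewrite eP (subset_trans eA AU) !andbT; apply: contraR eP => eI.
  have /set0Pn[w we] := ends_neq0 e.
  apply/exists_inP; exists (block m I w).
    by apply: imset_f; apply: (subsetP AU); exact: (subsetP eA).
  exact: base_block bI (subsetP JH e eJ) eI we.
have cX (K : {set edge G}) : #|K| = \sum_(B in P) #|inside K B| + #|crossing K P|.
  exact: card_crossing.
have cJ := cX (inside J A); have cI := cX (inside I U).
have sI : \sum_(B in P) #|inside (inside I U) B| + m * #|P| = m * #|U|.
  rewrite -(sum_tight pP tightP); congr (_ + _); apply: eq_bigr => B BP.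
  congr #|pred_of_set _|; apply/setP => e; rewrite !in_inside.
  by case: (boolP (ends e \subset B)) => [/subset_trans/(_ (PU B BP)) ->|]; rewrite ?andbT ?andbF.
(* Every block in [P] meets [A] by [PA], so sparsity of [J] applies to each [A :&: B]. *)
have sJ' : \sum_(B in P) #|inside (inside J A) B| + m * #|P| <= m * #|A|.
  rewrite (card_partition_setI pP AU) big_distrr /= mulnC -sum_nat_const -big_split.
  apply: leq_sum => B BP; apply: leq_trans (sparseP _ _ sJ _ (PA B BP)).
  rewrite leq_add2r subset_leq_card //; apply/subsetP => e.
  by rewrite !in_inside subsetI => /andP[/andP[-> ->] ->].
have vU : v \in U by exact: (subsetP AU).
have U0 : U != set0 by apply/set0Pn; exists v.
apply: (subset_trans AU); apply: block_max vU; rewrite /tight U0 /=.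
have := subset_leq_card sub; have := sparseP _ _ base_sparse _ U0.
have := tight_card tJ; move: cJ cI sI sJ'; clear; move=> *; apply/eqP; lia.
Qed.

Lemma tree_connected_tight A : A \subset sv H -> tight m I A ->
  tree_connected m (induced H A).
Proof.
move=> AH tA; apply/(tree_connected_tightP m_gt0 AH); exists I.
by split=> //; case: bI.
Qed.

Lemma tc_componentP A :
  reflect (exists2 v, v \in sv H & A = block m I v) (tc_component m H A).
Proof.
have tB v : v \in sv H -> tree_connected m (induced H (block m I v)).
  by move=> vH; apply: tree_connected_tight (block_sv vH) (tight_block _ base_sparse).
apply: (iffP maxsetP) => [[/andP[AH /asboolP tA] maxA]|[v vH ->]].
  have /set0Pn[v] : sv (induced H A) != set0 by case: tA.
  rewrite inE => /andP[vH vA]; exists v => //; apply/esym/maxA.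
    by rewrite block_sv //; apply/asboolP/tB.
  exact: tree_connected_block.
split; first by rewrite block_sv //; apply/asboolP/tB.
move=> B /andP[BH /asboolP tcB] sB; apply/eqP; rewrite eqEsubset sB andbT.
by apply: tree_connected_block => //; exact: (subsetP sB _ (mem_block _ _ _)).
Qed.

Lemma tc_partition_blocks : tc_partition m H = blocks m I (sv H).
Proof.
apply/setP => A; rewrite inE; apply/tc_componentP/imsetP => -[v vH ->]; by exists v.
Qed.

(** Summing tightness over the blocks counts the base edges inside them. The remaining base edges
    are all the edges of [H] between blocks, since an edge outside the base lies in one block. *)
Lemma Omega_base : (Omega m H + #|I|%:Z = (m * #|sv H|)%:Z)%R.
Proof.
have pP := blocks_partition; have [/eqP cP tP P0] := and3P pP.
rewrite /Omega tc_partition_blocks; set P := blocks m I (sv H) in pP cP tP P0 *.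
have -> : crossing_edges H P = #|crossing I P|.
  congr #|pred_of_set _|; apply/setP => e; rewrite !inE.
  apply/andP/andP => [[eH]|[eI eP]].
    case/exists_inP => A AP /exists_inP[B BP /and3P[AB]].
    move=> /set0Pn[a] /setIP[ae aA] /set0Pn[b] /setIP[be bB].
    have eP : ~~ [exists B in P, ends e \subset B].
      apply/exists_inP => -[C CP /subsetP eC].
      have eAC : A = C.
        by rewrite -(def_pblock tP AP aA) (def_pblock tP CP) ?eC.
      have eBC : B = C.
        by rewrite -(def_pblock tP BP bB) (def_pblock tP CP) ?eC.
      by rewrite eAC eBC eqxx in AB.
    rewrite eP; split=> //; apply: contraR eP => eI.
    apply/exists_inP; exists (block m I a); last exact: base_block bI eH eI ae.
    by apply: imset_f; apply: (subsetP (se_sub eH)).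
  have eH : e \in se H by have [/subsetP s _ _] := bI; exact: s.
  split=> //; have /set0Pn[a ae] := ends_neq0 e; have [b ba ee] := ends_pair ae.
  have be : b \in ends e by rewrite ee set22.
  have [aH bH] := (subsetP (se_sub eH) a ae, subsetP (se_sub eH) b be).
  apply/exists_inP; exists (block m I a); first exact: imset_f.
  apply/exists_inP; exists (block m I b); first exact: imset_f.
  apply/and3P; split.
  - apply: contraNneq eP => eab; apply/exists_inP; exists (block m I a).
      exact: imset_f.
    by rewrite ee subUset !sub1set mem_block eab mem_block.
  - by apply/set0Pn; exists a; rewrite inE ae mem_block.
  - by apply/set0Pn; exists b; rewrite inE be mem_block.
have : #|I| = \sum_(B in P) #|inside I B| + #|crossing I P| by exact: card_crossing.
have : \sum_(B in P) #|inside I B| + m * #|P| = m * #|sv H|.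
  apply: sum_tight => // _ /imsetP[v _ ->]; exact: tight_block base_sparse.
change (\sum_(B in P) #|inside I B| + m * #|P| = m * #|sv H| ->
  #|I| = \sum_(B in P) #|inside I B| + #|crossing I P| ->
  ((m * #|P|)%:Z - #|crossing I P|%:Z + #|I|%:Z = (m * #|sv H|)%:Z)%R).
lia.
Qed.

End Components.

Lemma Omega_sparse_le m H I : 0 < m -> I \subset se H -> sparse m I ->
  (Omega m H + #|I|%:Z <= (m * #|sv H|)%:Z)%R.
Proof.
move=> m0 IH sI; have [I' bI' II'] := base_extend IH sI.
rewrite -(Omega_base m0 bI') lerD2l lez_nat; exact: subset_leq_card.
Qed.

End Bases.

(** * The exchange argument *)


Section Exchange.
Variables (G : mgraph) (m : nat) (J : {set edge G}) (h : G -> nat).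
Implicit Types (I K : {set edge G}) (W X Y Z : {set G}) (e f : edge G).

Definition extra_degree I v := #|[set e in I :\: J | v \in ends e]|.

Definition feasible I :=
  [&& sparse m I, J \subset I & [forall v, extra_degree I v <= h v]].

(** For [W] the saturated set this is the edge set [L]; smaller [W] serve the stages leading up to
    that set. *)
Definition trunc W I := J :|: [set e in I | [disjoint ends e & W]].

Definition agree_off X I K :=
  [forall e, ~~ (ends e \subset X) ==> ((e \in I) == (e \in K))].

Lemma agree_offP X I K :
  reflect (forall e, ~~ (ends e \subset X) -> (e \in I) = (e \in K)) (agree_off X I K).
Proof.
by apply: (iffP forallP) => H e; [move/(implyP (H e))/eqP | apply/implyP => /H ->].
Qed.

Lemma trunc_sub W I : J \subset I -> trunc W I \subset I.
Proof. by move=> JI; rewrite subUset JI; apply/subsetP => e; rewrite inE => /andP[]. Qed.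

Lemma truncS W W' I : W \subset W' -> trunc W' I \subset trunc W I.
Proof.
move=> s; apply/setUS/subsetP => e; rewrite !inE => /andP[-> /=].
exact: disjointWr.
Qed.

Lemma trunc0 I : J \subset I -> trunc set0 I = I.
Proof.
move=> JI; apply/setP => e; rewrite !inE disjoints_subset setC0 subsetT andbT.
by case: (boolP (e \in J)) => //= /(subsetP JI) ->.
Qed.

Lemma in_trunc W I e : (e \in trunc W I) = (e \in J) || (e \in I) && [disjoint ends e & W].
Proof. by rewrite !inE. Qed.

Lemma agree_trunc W X I K : agree_off X I K -> agree_off X (trunc W I) (trunc W K).
Proof. by move/agree_offP => H; apply/agree_offP => e /H; rewrite !in_trunc => ->. Qed.

Lemma card_inside_agree X Z I K : agree_off X I K ->
  #|inside I X| = #|inside K X| -> X \subset Z -> #|inside I Z| = #|inside K Z|.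
Proof.
move=> /agree_offP H eX XZ.
have split_inside L : #|inside L Z| = #|inside L X| + #|inside L Z :\: inside L X|.
  by rewrite -(cardsID (inside L X) (inside L Z)) (setIidPr _) // insideSr.
rewrite !split_inside eX; congr (_ + #|pred_of_set _|); apply/setP => e.
rewrite !inE; case: (boolP (ends e \subset X)) => [eX'|/H ->//].
by rewrite (subset_trans eX' XZ) !andbT !andNb.
Qed.

Lemma feasible_sparse I : feasible I -> sparse m I.
Proof. by case/and3P. Qed.

Lemma feasible_sub I : feasible I -> J \subset I.
Proof. by case/and3P. Qed.

Lemma feasible_degree I v : feasible I -> extra_degree I v <= h v.
Proof. by case/and3P => _ _ /forallP. Qed.

Lemma sparse_trunc W I : feasible I -> sparse m (trunc W I).
Proof.
move=> fI; apply: sparseS (feasible_sparse fI); exact: trunc_sub (feasible_sub fI).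
Qed.

Lemma tight_truncS W W' I X : feasible I -> W \subset W' ->
  tight m (trunc W' I) X -> tight m (trunc W I) X.
Proof. by move=> fI s; apply: tightS (truncS _ s) (sparse_trunc _ fI). Qed.

Lemma tight_trunc W I X : feasible I -> tight m (trunc W I) X -> tight m I X.
Proof.
move=> fI; apply: tightS (feasible_sparse fI); exact: trunc_sub (feasible_sub fI).
Qed.

Lemma extra_degreeU I e v : extra_degree (e |: I) v <= extra_degree I v + (v \in ends e).
Proof.
rewrite /extra_degree addnC; case: (boolP (v \in ends e)) => ve.
  apply: (@leq_trans #|e |: [set f in I :\: J | v \in ends f]|).
    apply: subset_leq_card; apply/subsetP => f; rewrite !inE.
    by case: eqP => //= _ /andP[/andP[-> ->] ->].
  by rewrite cardsU1 leq_add2r leq_b1.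
apply: subset_leq_card; apply/subsetP => f; rewrite !inE.
by case: (f =P e) => [->|_] //=; rewrite (negPf ve) andbF.
Qed.

Lemma extra_degreeS I K v : I \subset K -> extra_degree I v <= extra_degree K v.
Proof.
move=> s; apply: subset_leq_card; apply/subsetP => f; rewrite !inE.
by case/andP => /andP[-> /(subsetP s) ->] ->.
Qed.

Lemma extra_degreeD I f v : f \in I -> f \notin J -> v \in ends f ->
  extra_degree I v = (extra_degree (I :\ f) v).+1.
Proof.
move=> fI fJ vf; rewrite /extra_degree (cardsD1 f) !inE fI fJ vf add1n; congr _.+1.
congr #|pred_of_set _|; apply/setP => g; rewrite !inE.
by case: (g \in J); case: (g == f); case: (g \in I).
Qed.

Section Optimum.
Variable I0 : {set edge G}.
Hypotheses (fI0 : feasible I0) (maxI0 : forall I, feasible I -> #|I| <= #|I0|).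

(* [slack W u]: the degree of [u] can be pushed below [h u] by an exchange
   inside a set that is tight even without the edges outside [J] meeting [W]. *)
Definition slack W u := (u \notin W) && [exists X : {set G}, exists I : {set edge G},
  [&& u \in X, tight m (trunc W I0) X, tight m (trunc W I) X, feasible I
    & agree_off X I I0 && (extra_degree I u < h u)]].

Definition saturate W := [set u | ~~ slack W u].

(** In the least fixed point each vertex enters at a stage where it has no slack; the exchange
    argument contradicts this. *)
Definition saturated := fixset saturate.

(** A larger [W] leaves fewer edges in [trunc W], hence fewer tight sets to witness slack. *)
Lemma saturate_mono : {homo saturate : W W' / W \subset W'}.
Proof.
move=> W W' s; apply/subsetP => u; rewrite !inE; apply: contra.
case/andP => uW /existsP[X /existsP[I /and5P[uX t1 t2 fI p]]].
apply/andP; split; first by apply: contra uW; apply/subsetP.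
apply/existsP; exists X; apply/existsP; exists I.
by rewrite uX (tight_truncS fI0 s t1) (tight_truncS fI s t2) fI.
Qed.

Lemma saturatedK : saturate saturated = saturated.
Proof. exact: fixsetK saturate_mono. Qed.

Lemma slack_saturated u : u \notin saturated -> slack saturated u.
Proof. by rewrite -{1}saturatedK inE negbK. Qed.

Lemma first_level (Q : pred {set G}) : ~~ Q set0 -> Q saturated ->
  exists W, [/\ W \subset saturated, ~~ Q W & Q (saturate W)].
Proof.
move=> Q0 QS; have ex : exists n, Q (iter n saturate set0) by exists #|G|.
case: (ex_minnP ex) => -[|n] Qn minn; first by rewrite Qn in Q0.
exists (iter n saturate set0); split=> //; first exact: iter_sub_fix saturate_mono _.
by apply/negP => /minn; rewrite ltnn.
Qed.

(** A vertex of extra degree below [h u] has slack at every stage before it enters, witnessed by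
    [I0] itself and the tight set [[set u]]. *)
Lemma saturated_degree u : u \in saturated -> extra_degree I0 u = h u.
Proof.
move=> uS; have [|W [_ uW]] := @first_level (fun W => u \in W) _ uS.
  by rewrite inE.
rewrite inE /slack uW /=; move=> nsl; apply/eqP; rewrite eqn_leq feasible_degree //=.
rewrite leqNgt; apply: contra nsl => lt.
apply/existsP; exists [set u]; apply/existsP; exists I0.
by rewrite set11 !tight1 fI0 lt andbT /=; apply/agree_offP.
Qed.

Section Spanning.
Variables (e : edge G) (x y : G) (X Y : {set G}) (I1 I2 : {set edge G}).
Let S := saturated.
Hypotheses (eI0 : e \notin I0) (ee : ends e = [set x; y]) (eS : [disjoint ends e & S]).
Hypotheses (XY : [disjoint X & Y]) (xX : x \in X) (yY : y \in Y).
Hypotheses (tX0 : tight m (trunc S I0) X) (tX1 : tight m (trunc S I1) X).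
Hypotheses (tY0 : tight m (trunc S I0) Y) (tY2 : tight m (trunc S I2) Y).
Hypotheses (f1 : feasible I1) (f2 : feasible I2).
Hypotheses (a1 : agree_off X I1 I0) (a2 : agree_off Y I2 I0).
Hypotheses (dx : extra_degree I1 x < h x) (dy : extra_degree I2 y < h y).

Let K := [set f | if ends f \subset Y then f \in I2 else f \in I1].

Let notX f v : v \in Y -> v \in ends f -> ~~ (ends f \subset X).
Proof.
move=> vY vf; apply/negP => /subsetP/(_ _ vf) vX.
by have := disjoint_setI0 XY => /setP/(_ v); rewrite !inE vX vY.
Qed.

Let notY f v : v \in X -> v \in ends f -> ~~ (ends f \subset Y).
Proof.
move=> vX vf; apply/negP => /subsetP/(_ _ vf) vY.
by have := disjoint_setI0 XY => /setP/(_ v); rewrite !inE vX vY.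
Qed.

Let insideX f : ends f \subset X -> ~~ (ends f \subset Y).
Proof.
have /set0Pn[v vf] := ends_neq0 f; move=> /subsetP/(_ _ vf) vX; exact: notY vf.
Qed.

Let KY f : ends f \subset Y -> (f \in K) = (f \in I2).
Proof. by rewrite inE => ->. Qed.

Let KnY f : ~~ (ends f \subset Y) -> (f \in K) = (f \in I1).
Proof. by rewrite inE => /negPf ->. Qed.

Let K0 f : ~~ (ends f \subset X) -> ~~ (ends f \subset Y) -> (f \in K) = (f \in I0).
Proof. by move=> fX fY; rewrite KnY // (agree_offP _ _ _ a1). Qed.

Let aK1 : agree_off Y K I1.
Proof. by apply/agree_offP => f /KnY. Qed.

Let JK : J \subset K.
Proof.
apply/subsetP => f fJ; rewrite inE.
by case: ifP => _; [exact: (subsetP (feasible_sub f2)) | exact: (subsetP (feasible_sub f1))].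
Qed.

Let truncKY W : inside (trunc W K) Y = inside (trunc W I2) Y.
Proof.
apply/setP => f; rewrite !in_inside !in_trunc.
by case: (boolP (ends f \subset Y)) => [/KY ->|]; rewrite ?andbF.
Qed.

Let truncKX W : inside (trunc W K) X = inside (trunc W I1) X.
Proof.
apply/setP => f; rewrite !in_inside !in_trunc.
by case: (boolP (ends f \subset X)) => [/insideX/KnY ->|]; rewrite ?andbF.
Qed.

Let trunc1Y W : inside (trunc W I1) Y = inside (trunc W I0) Y.
Proof.
apply/setP => f; rewrite !in_inside !in_trunc.
case: (boolP (ends f \subset Y)) => [fY|]; rewrite ?andbF //.
rewrite (agree_offP _ _ _ a1) //.
have /set0Pn[v vf] := ends_neq0 f; exact: notX (subsetP fY v vf) vf.
Qed.

(** Both exchanges take place inside sets that are tight before and after, so they preserve the edge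
    counts in [X] and [Y], hence in every set containing both. *)
Let trunc_transfer W Z : W \subset S -> X \subset Z -> Y \subset Z ->
  #|inside (trunc W K) Z| = #|inside (trunc W I0) Z|.
Proof.
move=> WS XZ YZ.
have cY := tight_card (tight_truncS fI0 WS tY0).
have cY2 := tight_card (tight_truncS f2 WS tY2).
have cX := tight_card (tight_truncS fI0 WS tX0).
have cX1 := tight_card (tight_truncS f1 WS tX1).
rewrite (card_inside_agree (agree_trunc W aK1) _ YZ).
  apply: card_inside_agree (agree_trunc W a1) _ XZ.
  by apply/eqP; rewrite -(eqn_add2r m) cX cX1.
by rewrite truncKY trunc1Y; apply/eqP; rewrite -(eqn_add2r m) cY cY2.
Qed.

(** [sparse_glue] applies, since [Y] is tight for [I1]: inside [Y] the sets [I1] and [I0] agree. *)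
Let sparseK : sparse m K.
Proof.
have t1Y : tight m I1 Y.
  rewrite (@eq_tight _ _ _ I0); first exact: tight_trunc tY0.
  by rewrite -(trunc0 (feasible_sub f1)) -(trunc0 (feasible_sub fI0)) trunc1Y.
apply: sparseS (sparse_glue (feasible_sparse f1) (feasible_sparse f2) t1Y).
apply/subsetP => f; rewrite !inE; case: (boolP (ends f \subset Y)) => _ -> //.
by rewrite orbT.
Qed.

Let cardK : #|K| = #|I0|.
Proof.
have insideT (L : {set edge G}) : inside L setT = L.
  by apply/setP => f; rewrite in_inside subsetT andbT.
have := trunc_transfer (sub0set S) (subsetT X) (subsetT Y).
by rewrite !insideT !trunc0 // (feasible_sub fI0).
Qed.

Let degK v : extra_degree K v = if v \in Y then extra_degree I2 v else extra_degree I1 v.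
Proof.
rewrite /extra_degree; case: ifP => vY; congr #|pred_of_set _|; apply/setP => f;
  rewrite in_set [in RHS]in_set !in_setD; case: (boolP (v \in ends f)) => [vf|]; rewrite ?andbF //.
  rewrite !andbT; congr (_ && _); case: (boolP (ends f \subset Y)) => [/KY //|fY].
  by rewrite (agree_offP _ _ _ a2) // K0 // (notX vY).
by rewrite KnY //; apply/negP => /subsetP/(_ _ vf); rewrite vY.
Qed.

Let feasibleK : feasible K.
Proof.
apply/and3P; split=> //; apply/forallP => v; rewrite degK.
by case: ifP => _; exact: feasible_degree.
Qed.

Let xe : x \in ends e. Proof. by rewrite ee set21. Qed.
Let ye : y \in ends e. Proof. by rewrite ee set22. Qed.

Let eK : e \notin K.
Proof. by rewrite K0 // ?(notX yY ye) ?(notY xX xe). Qed.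

Let deg_add v : extra_degree (e |: K) v <= h v.
Proof.
apply: leq_trans (extra_degreeU _ _ _) _; rewrite ee !inE.
have dK := feasible_degree v feasibleK.
have [->|vx] := eqVneq v x.
  rewrite addn1 degK; case: ifP => // xY.
  by have := disjoint_setI0 XY => /setP/(_ x); rewrite !inE xX xY.
by have [->|_] := eqVneq v y; [rewrite addn1 degK yY | rewrite addn0].
Qed.

Let nsparse_add : ~~ sparse m (e |: K).
Proof.
apply/negP => sp; have /maxI0 : feasible (e |: K).
  rewrite /feasible sp (subset_trans JK) ?subsetUr //=; exact/forallP.
by rewrite cardsU1 eK cardK add1n ltnn.
Qed.

(* The exchanges at [x] and [y] take place in disjoint sets, so both can be made
   at once; call the result [K].  Maximality makes [e |: K] dependent.  If the
   minimal tight set of [e] used an edge outside [J] meeting [S], then swapping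
   [e] for such an edge that meets the earliest level of [S] would give slack to
   a vertex of that level. *)
Lemma spanned_union : exists2 Z, tight m (trunc S I0) Z & ends e \subset Z.
Proof.
have [A' tA' eA'] := nsparse_tight sparseK nsparse_add.
have [A [tA eA minA]] := ex_min_tight sparseK tA' eA'.
have [xA yA] := (subsetP eA x xe, subsetP eA y ye).
pose Z := A :|: X :|: Y.
have XZ : X \subset Z by rewrite /Z setUAC subsetUr.
have YZ : Y \subset Z by rewrite /Z subsetUr.
have AZ : A \subset Z by rewrite /Z -setUA subsetUl.
have eZ : ends e \subset Z by exact: subset_trans eA AZ.
(* The minimal tight set of [e] uses an edge of [K] that [trunc W] deletes. *)
pose touch W := [exists f in K, [&& f \notin J, ends f \subset A & ~~ [disjoint ends f & W]]].
have tZ W : W \subset S -> ~~ touch W -> tight m (trunc W K) Z.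
  move=> WS /exists_inP nt.
  have tAW : tight m (trunc W K) A.
    rewrite (@eq_tight _ _ _ K) //; congr #|pred_of_set _|.
    apply/setP => f; rewrite !in_inside in_trunc.
    case: (boolP (ends f \subset A)) => fA; rewrite ?andbF // !andbT.
    case: (boolP (f \in J)) => [/(subsetP JK) ->//|fJ] /=.
    case: (boolP (f \in K)) => //= fK; apply/negPn/negP => fW.
    by apply: nt; exists f => //; rewrite fJ fA.
  have tXW : tight m (trunc W K) X.
    by rewrite (@eq_tight _ _ _ (trunc W I1)) ?truncKX //; exact: tight_truncS WS tX1.
  have tYW : tight m (trunc W K) Y.
    by rewrite (@eq_tight _ _ _ (trunc W I2)) ?truncKY //; exact: tight_truncS WS tY2.
  have sW := sparse_trunc W feasibleK.
  apply: (tightU sW (tightU sW tAW tXW xA xX) tYW _ yY).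
  by rewrite inE yA.
have tZ0 W : W \subset S -> ~~ touch W -> tight m (trunc W I0) Z.
  by move=> WS nt; rewrite -(eq_tight m (trunc_transfer WS XZ YZ)) tZ.
case: (boolP (touch S)) => [tS|]; last by exists Z => //; exact: tZ0.
(* [W] is the stage just before the first touched one, so the edge [f] found below avoids [W] but
   meets [saturate W] at some [z]. *)
have [|W [WS nW tW]] := first_level _ tS.
  apply/exists_inP => -[f _ /and3P[_ _]].
  by rewrite disjoints_subset setC0 subsetT.
case/exists_inP: tW => f fK /and3P[fJ fA].
rewrite -setI_eq0 => /set0Pn[z /setIP[zf zW]].
have fW : [disjoint ends f & W].
  by apply/negPn/negP => fW; case/exists_inP: nW; exists f => //; rewrite fJ fA.
have zW' : z \notin W.
  by apply/negP => zW'; have /setP/(_ z) := disjoint_setI0 fW; rewrite !inE zf zW'.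
have zS : z \in S.
  by rewrite /S -saturatedK; apply: (subsetP (saturate_mono WS)).
have ze : z \notin ends e.
  by apply/negP => ze; have /setP/(_ z) := disjoint_setI0 eS; rewrite !inE ze zS.
have eW : [disjoint ends e & W] by exact: disjointWr eS.
pose L := e |: (K :\ f).
have eKf : e \notin K :\ f by rewrite in_setD1 (negPf eK) andbF.
have eJ : e \notin J by apply: contra eK; exact: (subsetP JK).
have sL : sparse m L by exact: (sparse_exchange sparseK eK fK minA fA).
have JL : J \subset L.
  apply/subsetP => g gJ; rewrite in_setU1 in_setD1 (subsetP JK) // andbT.
  by apply/orP; right; apply: contraNneq fJ => <-.
have LK v : extra_degree L v <= extra_degree (e |: K) v.
  by apply: extra_degreeS; apply/setUS/subsetDl.
have fL : feasible L.
  rewrite /feasible sL JL; apply/forallP => v; exact: leq_trans (LK v) (deg_add v).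
have trL : trunc W L = e |: (trunc W K :\ f).
  apply/setP => g; rewrite !(in_setU1, in_setD1, in_trunc).
  have [->|_] /= := eqVneq g e; first by rewrite eW orbT.
  by have [->|_] //= := eqVneq g f; rewrite (negPf fJ).
(* [e] and [f] both lie in [Z] and avoid [W], so the swap keeps the count in [Z]. *)
have tL : tight m (trunc W L) Z.
  rewrite (@eq_tight _ _ _ (trunc W K)); first exact: tZ.
  rewrite trL inside_add //; last first.
    by rewrite in_setD1 in_trunc (negPf eK) (negPf eJ) andbF.
  rewrite [RHS](@inside_del _ _ _ f) ?(subset_trans fA AZ) //.
  by rewrite in_trunc fK fW orbT.
have aL : agree_off Z L I0.
  apply/agree_offP => g gZ; rewrite in_setU1 in_setD1.
  have [ge|_] /= := eqVneq g e; first by rewrite ge eZ in gZ.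
  have [gf|_] /= := eqVneq g f; first by rewrite gf (subset_trans fA AZ) in gZ.
  by rewrite K0 //; apply: contra gZ => /subset_trans; apply.
(* [z] loses [f] and does not gain [e], which avoids [S]. *)
have dL : extra_degree L z < h z.
  apply: leq_trans (feasible_degree z feasibleK); rewrite (extra_degreeD fK fJ zf) ltnS.
  by apply: leq_trans (extra_degreeU _ _ _) _; rewrite (negPf ze) addn0.
move: zW; rewrite inE /slack zW' => /negP[]; apply/existsP; exists Z.
apply/existsP; exists L; rewrite tZ0 // tL fL aL dL !andbT.
by apply: (subsetP AZ); apply: (subsetP fA).
Qed.

End Spanning.

(** If the slack witnesses at the two ends meet, their union is tight and contains [e]; otherwise
    [spanned_union] applies. *)
Lemma saturated_spans e : e \notin I0 -> [disjoint ends e & saturated] ->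
  exists2 Z, tight m (trunc saturated I0) Z & ends e \subset Z.
Proof.
move=> eI eS; have /set0Pn[x xe] := ends_neq0 e; have [y _ ee] := ends_pair xe.
have notS v : v \in ends e -> v \notin saturated.
  by move=> ve; apply/negP => vS; have /setP/(_ v) := disjoint_setI0 eS; rewrite !inE ve vS.
have /andP[_ /existsP[X /existsP[I1 /and5P[xX tX0 tX1 f1 /andP[a1 dx]]]]] :=
  slack_saturated (notS x xe).
have ye : y \in ends e by rewrite ee set22.
have /andP[_ /existsP[Y /existsP[I2 /and5P[yY tY0 tY2 f2 /andP[a2 dy]]]]] :=
  slack_saturated (notS y ye).
have [XY|] := boolP [disjoint X & Y].
  exact: (spanned_union eI ee eS XY xX yY tX0 tX1 tY0 tY2 f1 f2 a1 a2 dx dy).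
rewrite -setI_eq0 => /set0Pn[v /setIP[vX vY]].
exists (X :|: Y); first exact: tightU (sparse_trunc _ fI0) tX0 tY0 vX vY.
by rewrite ee subUset !sub1set !inE xX yY orbT.
Qed.

End Optimum.
End Exchange.

(** * Counting over the blocks *)


Lemma card_setIdE (T : finType) (K : {set T}) (Q : pred T) :
  #|[set e in K | Q e]| = \sum_(e in K) Q e.
Proof.
rewrite -sum1_card big_mkcond [RHS]big_mkcond /=; apply: eq_bigr => e _.
by rewrite inE; case: (e \in K); case: (Q e).
Qed.

Lemma card_setIE (T : finType) (A B : {set T}) : #|A :&: B| = \sum_(v in B) (v \in A).
Proof.
by rewrite setIC -card_setIdE.
Qed.

Section Counting.
Variables (G : mgraph) (m : nat).
Implicit Types (I J K R : {set edge G}) (S A B D : {set G}).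

Definition touching K S := [set e in K | ~~ [disjoint ends e & S]].

Definition cut K B := [set e in K | #|ends e :&: B| == 1].

(** An edge counts once for each end in [S]: [touching] records the first, [inside] the second. *)
Lemma sum_degree K S : \sum_(v in S) #|[set e in K | v \in ends e]| =
  #|touching K S| + #|inside K S|.
Proof.
under eq_bigr => v _ do rewrite card_setIdE.
rewrite exchange_big !card_setIdE -big_split; apply: eq_bigr => e _ /=.
rewrite -card_setIE -setI_eq0 -(sameP eqP setIidPl) [_ == ends e]eqEcard subsetIl card_ends /=.
have := subset_leq_card (subsetIl (ends e) S); rewrite card_ends -cards_eq0.
by case: #|_| => [|[|[|]]].
Qed.

Section Blocks.
Variables (F : subgraph G) (I J : {set edge G}) (S : {set G}).
Hypotheses (m_gt0 : 0 < m) (bJ : base m (se F) J) (factF : factor F).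
Hypotheses (JI : J \subset I) (sI : sparse m I).
Hypothesis touchJ : forall e, e \in I -> ~~ [disjoint ends e & S] -> e \in J.

Let P := blocks m I [set: G].

Let pP : partition P [set: G].
Proof. by apply: block_partition => // v _; exact: subsetT. Qed.

Let tP : trivIset P. Proof. by case/and3P: pP. Qed.

Let tightP D : D \in P -> tight m I D.
Proof. by case/imsetP => v _ ->; exact: tight_block. Qed.

Lemma block_tight_base D : D \in P -> D \subset S -> tight m J D.
Proof.
move=> /tightP tD DS; rewrite (@eq_tight _ _ _ I) //; congr #|pred_of_set _|.
apply/setP => e; rewrite !in_inside; case: (boolP (ends e \subset D)) => eD; rewrite ?andbF //.
rewrite !andbT; apply/idP/idP => [/(subsetP JI) //|eI]; apply: touchJ => //.
rewrite -setI_eq0 (setIidPl _) ?ends_neq0 //; exact: subset_trans eD DS.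
Qed.

(** [D] is tight for the base [J] of [F], and it is a whole block of [J] because tight sets of [J]
    are tight for [I]. *)
Lemma block_tc_component D : D \in P -> D \subset S -> tc_component m F D.
Proof.
move=> DP DS; have tD := block_tight_base DP DS.
case/imsetP: DP tD => v _ -> tD.
have vF : v \in sv F by rewrite (eqP factF) inE.
apply/(tc_componentP m_gt0 bJ); exists v => //; apply/eqP.
rewrite eqEsubset (block_max tD (mem_block _ _ _)) /=.
have sJ : sparse m J by case: bJ.
by apply: block_max (mem_block _ _ _); apply: tightS JI sI _; exact: tight_block.
Qed.

(** An edge of [F] outside [J] lies within one block, so all edges leaving the component belong to
    [J]. *)
Lemma cut_degree_base D : tc_component m F D -> cut_degree F D <= #|cut J D|.
Proof.
case/(tc_componentP m_gt0 bJ) => v vF eD; apply: subset_leq_card.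
apply/subsetP => e; rewrite !inE => /andP[eF c1]; rewrite c1 andbT.
apply: contraLR c1 => eJ.
have [->//|/set0Pn[w /setIP[we wD]]] := eqVneq (ends e :&: D) set0; first by rewrite cards0.
suff /setIidPl -> : ends e \subset D by rewrite card_ends.
have sJ : sparse m J by case: bJ.
rewrite eD -(block_eq sJ (_ : w \in _)) -?eD //.
exact: base_block bJ eF eJ we.
Qed.

Lemma sum_inside_blocks :
  \sum_(D in P | D \subset S) #|inside J D| <= #|inside J S|.
Proof.
have -> : #|inside J S| = \sum_(B in P) #|inside (inside J S) B| + #|crossing (inside J S) P|.
  exact: card_crossing.
apply: leq_trans (leq_addr _ _); rewrite big_mkcondr /= leq_sum // => D _.
case: ifP => // DS; apply: subset_leq_card; apply/subsetP => e.
rewrite !in_inside => /andP[-> eD]; rewrite eD andbT; exact: subset_trans eD DS.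
Qed.

(** An edge of [J] leaving a block inside [S] joins different blocks and meets [S]; with two ends,
    it leaves at most two blocks. *)
Lemma sum_cut_blocks :
  \sum_(D in P | D \subset S) #|cut J D| <= 2 * #|touching (crossing J P) S|.
Proof.
under eq_bigr => D _ do rewrite card_setIdE.
rewrite exchange_big /=.
have -> : 2 * #|touching (crossing J P) S| =
    \sum_(e in J) 2 * (e \in touching (crossing J P) S).
  rewrite -big_distrr -card_setIdE; congr (_ * #|pred_of_set _|).
  by apply/setP => e; rewrite !inE; case: (e \in J).
apply: leq_sum => e eJ; case: (boolP (e \in touching _ _)) => [_|nt].
  rewrite muln1 -(card_ends e) (card_partition_setI pP (subsetT _)).
  rewrite big_mkcondr /= leq_sum // => D _; case: ifP => // _.
  by case: eqP => [->|].
rewrite big1 // => D /andP[DP DS]; apply/eqP; rewrite eqb0.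
apply: contra nt => /cards1P[w eDw].
have /setIP[we wD] : w \in ends e :&: D by rewrite eDw set11.
rewrite !inE eJ /=; apply/andP; split.
  apply/exists_inP => -[B BP eB].
  have BD : B = D by rewrite -(def_pblock tP BP (subsetP eB w we)) (def_pblock tP DP wD).
  have := card_ends e; rewrite -(setIidPl (_ : ends e \subset D)) ?eDw ?cards1 // -BD //.
by rewrite -setI_eq0; apply/set0Pn; exists w; rewrite inE we (subsetP DS).
Qed.

(** Inside a block [B], [I] has [m (#|B| - 1)] edges and [R] at most [m (#|B :\: S| - 1)], or none
    if [B] lies in [S]. Between blocks, the edges of [R] belong to [I] and avoid [S], so the edges
    of [J] touching [S] come in addition. *)
Lemma card_avoiding R : sparse m R ->
  (forall e, e \in R -> [disjoint ends e & S]) ->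
  (forall e, e \in R -> e \notin I -> exists2 Z, tight m I Z & ends e \subset Z) ->
  #|R| + m * #|S| + #|touching (crossing J P) S| <=
  #|I| + m * (\sum_(D in P | D \subset S) 1).
Proof.
move=> sR avoidR spanR.
have split_card K : #|K| = \sum_(B in P) #|inside K B| + #|crossing K P|.
  exact: card_crossing.
have cI := split_card I; have cR := split_card R.
have sI' : \sum_(B in P) #|inside I B| + m * #|P| = m * #|[set: G]|.
  by apply: sum_tight => // B; exact: tightP.
have sR' : \sum_(B in P) #|inside R B| + m * #|P| <=
    m * #|~: S| + m * (\sum_(D in P | D \subset S) 1).
  rewrite (card_partition_setI pP (subsetT (~: S))) big_mkcondr !big_distrr /=.
  rewrite mulnC -sum_nat_const -!big_split; apply: leq_sum => B BP /=.
  have -> : inside R B = inside R (~: S :&: B).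
    apply/setP => e; rewrite !in_inside subsetI.
    by case: (boolP (e \in R)) => //= /avoidR; rewrite disjoints_subset => ->.
  (* A block inside [S] leaves no vertex to which sparsity could apply; the extra [m] on the right
     makes up for it. *)
  have [e0|ne] := eqVneq (~: S :&: B) set0.
    have -> : B \subset S.
      by apply/subsetP => v vB; apply/negPn/negP => vS; have /setP/(_ v) := e0; rewrite !inE vS vB.
    rewrite e0 cards0 muln0 muln1 add0n.
    rewrite (_ : inside R set0 = set0) ?cards0 //.
    by apply/setP => e; rewrite in_inside subset0 (negPf (ends_neq0 e)) andbF inE.
  by apply: leq_trans (leq_addr _ _); exact: (sparseP _ _ sR).
have sub : crossing R P :|: touching (crossing J P) S \subset crossing I P.
  rewrite subUset; apply/andP; split; apply/subsetP => e; rewrite !inE.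
    case/andP => eR eP; rewrite eP andbT; apply: contraR eP => eI.
    have [Z tZ eZ] := spanR e eR eI; have /set0Pn[v ve] := ends_neq0 e.
    apply/exists_inP; exists (block m I v); first exact: imset_f.
    by apply: (subset_trans eZ); apply: block_max => //; exact: (subsetP eZ).
  by case/andP => /andP[/(subsetP JI) -> ->].
have dis : crossing R P :&: touching (crossing J P) S = set0.
  apply/setP => e; rewrite !inE; apply/negbTE/negP.
  by case/andP => /andP[/avoidR ->]; rewrite andbF.
have := subset_leq_card sub; rewrite cardsU dis cards0 subn0.
have : m * #|[set: G]| = m * #|S| + m * #|~: S| by rewrite -mulnDr cardsC cardsT.
move: cI cR sI' sR'; clear; lia.
Qed.

End Blocks.
End Counting.


(** * Optimal edge sets and the factor they yield *)

Lemma extra_degree_self (G : mgraph) (J : {set edge G}) v : extra_degree J J v = 0.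
Proof. by apply: eq_card0 => e; rewrite !inE andNb. Qed.

Lemma optimum_exists (G : mgraph) m (J : {set edge G}) (h : G -> nat) :
  sparse m J -> exists2 I, feasible m J h I &
    forall K, feasible m J h K -> #|K| <= #|I|.
Proof.
move=> sJ; have fJ : feasible m J h J.
  by rewrite /feasible sJ subxx; apply/forallP => v; rewrite extra_degree_self.
by case: (arg_maxnP (fun I : {set edge G} => #|I|) fJ) => I; exists I.
Qed.

Lemma induced_all (G : mgraph) (H : subgraph G) (A : {set G}) : sv H \subset A -> induced H A = H.
Proof.
move=> svA; have eV : sv (induced H A) = sv H by apply/setIidPl.
have eE : se (induced H A) = se H.
  apply/setP => e; rewrite inE; case: (boolP (e \in se H)) => //= eH.
  exact: subset_trans (se_sub eH) svA.
case: H svA eV eE => V E p svA /= eV eE; rewrite /induced /=.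
move: (@induced_subproof _ _ _); rewrite /= eV eE => p'; congr Subgraph; exact: Prop_irrelevance.
Qed.

(** [I] is tight on the whole vertex set, so [F] together with [I] is tree-connected; the edges of
    [I] outside [F] are outside [J], so the extra degree bounds their number at each vertex. *)
Lemma spanning_supergraph (G : mgraph) m (F : subgraph G) (h : G -> nat)
    (J I : {set edge G}) :
  0 < m -> 0 < #|G| -> base m (se F) J -> feasible m J h I ->
  #|I| + m = m * #|G| ->
  exists H : subgraph G, [/\ factor H, tree_connected m H, subgraph_le F H
    & forall v, degree H v <= h v + degree F v].
Proof.
move=> m0 G0 bJ fI cI.
have subT e : e \in se F :|: I -> ends e \subset [set: G] by move=> _; exact: subsetT.
pose H := Subgraph subT; exists H; split.
- by rewrite /factor.
- have insideT : inside I setT = I by apply/setP => e; rewrite in_inside subsetT andbT.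
  rewrite -(@induced_all _ H _ (subxx _)).
  apply/(tree_connected_tightP m0 (subxx _)); exists I; split.
  + exact: subsetUr.
  + exact: feasible_sparse fI.
  + by rewrite /tight insideT cI cardsT eqxx andbT -card_gt0 cardsT.
- by rewrite /subgraph_le subsetT subsetUl.
move=> v; apply: (@leq_trans (extra_degree J I v + degree F v)).
  rewrite /degree /extra_degree -cardsUI (leq_trans _ (leq_addr _ _)) //.
  apply: subset_leq_card; apply/subsetP => e; rewrite !inE.
  case: (boolP (e \in se F)) => eF /=; first by move=> ->; rewrite orbT.
  by case/andP => -> ->; have [/subsetP s _ _] := bJ; rewrite (contra (s e)).
by rewrite leq_add2r (feasible_degree v fI).
Qed.

(** * Numerical estimates and the theorem *)

Local Open Scope ring_scope.

(** [a] counts the base edges inside a component with [n] vertices and cut degree [d]. The bound is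
    the hypothesis multiplied by [m], less [m], divided by [c - 1]. *)
Lemma component_bound (R : realType) (m a d n : nat) (c : R) :
  (0 < m)%N -> 2 <= c -> (a + m = m * n)%N ->
  n%:R + (c - 1) / (2 * m%:R) * d%:R >= c ->
  m%:R <= (c - 1)^-1 * a%:R + d%:R / 2.
Proof.
move=> m0 c2 an H.
have m0' : 0 < m%:R :> R by rewrite ltr0n.
have c1 : 0 < c - 1 by lra.
have ea : a%:R = m%:R * n%:R - m%:R :> R by rewrite -natrM -an natrD addrK.
rewrite ea -(ler_pM2l c1) mulrDr mulrA divff ?mul1r; last by rewrite gt_eqF.
have {}H : m%:R * c <= m%:R * n%:R + (c - 1) * (d%:R / 2).
  have -> : m%:R * n%:R + (c - 1) * (d%:R / 2) =
      m%:R * (n%:R + (c - 1) / (2 * m%:R) * d%:R).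
    by field; rewrite gt_eqF.
  by rewrite ler_pM2l.
lra.
Qed.

(* [n], [s], [w] are the orders of [G], [S], [G \ S]; [OT], [OS] are [Omega] of
   [G \ S] and [G[S]]; [h] is the sum of the degree bounds over [S]; [t] and [b]
   count the edges of [I \ J] meeting [S] and inside [S], [e] those of [J] inside
   [S]; [i0], [i], [r] are the sizes of [I], of [L] and of a base of [G \ S]; [k]
   is the number of blocks of [L] inside [S] and [z] the number of edges of [J]
   that join different blocks and meet [S]. *)
Lemma bounds_contradiction (R : realType) (c OT OS m s h t b e r z k i0 i n w : R) :
  2 <= c -> b <= t -> h = t + b -> i + t = i0 -> i0 + m + 1 <= m * n ->
  n = s + w -> OT + r = m * w -> OS + (b + e) <= m * s ->
  r + m * s + z <= i + m * k -> m * k <= (c - 1)^-1 * e + z ->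
  OT < c / (2 * c - 2) * h - s * (m / (c - 1)) + m + 1 + (c - 1)^-1 * OS -> False.
Proof.
move=> c2 bt -> ei i0n en eOT eOS er ek; rewrite en mulrDr in i0n.
have c1 : c - 1 != 0 by rewrite gt_eqF //; lra.
have -> : c / (2 * c - 2) = (1 + (c - 1)^-1) / 2 by field; rewrite c1; apply/andP; split => //; lra.
have : 0 <= (c - 1)^-1 <= 1.
  by rewrite invr_ge0 invf_le1; lra.
set q := (c - 1)^-1 in ek * => /andP[q0 q1] lt.
have h1 : q * OS <= q * (m * s - (b + e)) by apply: ler_wpM2l => //; lra.
(* Half of this product is the amount by which [t + q * b] exceeds [(1 + q) / 2 * (t + b)]; [q <= 1]
   comes from [2 <= c]. *)
have h2 : 0 <= (1 - q) * (t - b) by apply: mulr_ge0; lra.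
(* The counts make [OT] at least [t + m + 1 - q * e], and the last hypothesis makes it smaller. *)
lra.
Qed.

Theorem theorem1p2 (R : realType) (m : nat) (c : R) (G : mgraph)
    (F : subgraph G) (h : G -> nat)
    (m_gt0 : (0 < m)%N) (c_ge2 : 2 <= c)
    (G_nonnull : (0 < #|G|)%N) (F_factor : factor F)
    (F_comp : forall C : {set G}, tc_component m F C ->
       #|C|%:R + (c - 1) / (2 * m%:R) * (cut_degree F C)%:R >= c)
    (Omega_bound : forall S : {set G},
       (Omega m (delete (whole G) S))%:~R <
         \sum_(v in S) (c / (2 * c - 2) * (h v)%:R - m%:R / (c - 1))
         + m%:R + 1 + (c - 1)^-1 * (Omega m (induced (whole G) S))%:~R) :
  exists H : subgraph G,
    [/\ factor H, tree_connected m H, subgraph_le F H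
      & forall v : G, (degree H v <= h v + degree F v)%N].
Proof.
have sparse0 : sparse m (set0 : {set edge G}).
  apply/sparseP => A A0; rewrite (_ : inside _ _ = set0) ?cards0 ?add0n.
    by rewrite leq_pmulr // card_gt0.
  by apply/setP => e; rewrite !inE.
have [J bJ _] := base_extend (sub0set (se F)) sparse0.
have sJ : sparse m J by case: bJ.
have [I fI maxI] := optimum_exists h sJ.
have sI := feasible_sparse fI; have JI := feasible_sub fI.
have insideT (K : {set edge G}) : inside K setT = K.
  by apply/setP => e; rewrite in_inside subsetT andbT.
have leI : (#|I| + m <= m * #|G|)%N.
  have T0 : [set: G] != set0 by rewrite -card_gt0 cardsT.
  by have := sparseP _ _ sI _ T0; rewrite insideT cardsT.
(* Either [I] is tight on the whole vertex set, or it is short by at least one edge, which is then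
   refuted. *)
move: leI; rewrite leq_eqVlt => /orP[/eqP eI|ltI].
  exact: spanning_supergraph m_gt0 G_nonnull bJ fI eI.
exfalso; pose S := saturated m J h I; pose L := trunc J S I.
have JL : J \subset L by exact: subsetUl.
have sL : sparse m L by exact: sparse_trunc fI.
have touchL e : e \in L -> ~~ [disjoint ends e & S] -> e \in J.
  by rewrite in_trunc => /orP[//|/andP[_ ->]].
have [K bK _] := base_extend (sub0set (se (delete (whole G) S))) sparse0.
have sK : sparse m K by case: bK.
have avoidK e : e \in K -> [disjoint ends e & S].
  by have [/subsetP s _ _] := bK; move/s; rewrite !inE /= disjoints_subset.
have spanK e : e \in K -> e \notin L -> exists2 Z, tight m L Z & ends e \subset Z.
  move=> eK eL; have dS := avoidK e eK; apply: saturated_spans => //.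
  by apply: contra eL => eI; rewrite in_trunc eI dS orbT.
have count := card_avoiding JL sL sK avoidK spanK.
pose P := blocks m L [set: G].
pose k := (\sum_(D in P | D \subset S) 1)%N.
pose z := #|touching (crossing J P) S|.
have comp_bound : m%:R * k%:R <= (c - 1)^-1 * #|inside J S|%:R + z%:R :> R.
  have le1 := sum_inside_blocks J S sL; have le2 := sum_cut_blocks J S sL.
  (* Each block inside [S] is a component of [F] and accounts for one [m]; the factor one half in
     the cut term offsets edges of [J] seen from two blocks. *)
  apply: (@le_trans _ _ (\sum_(D in P | D \subset S)
      ((c - 1)^-1 * #|inside J D|%:R + #|cut J D|%:R / 2))).
    rewrite natr_sum mulr_sumr; apply: ler_sum => D /andP[DP DS]; rewrite mulr1.
    have tcD := block_tc_component m_gt0 bJ F_factor JL sL touchL DP DS.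
    have tD := block_tight_base JL sL touchL DP DS.
    have cD := cut_degree_base m_gt0 bJ tcD.
    apply: le_trans (component_bound m_gt0 c_ge2 (tight_card tD) (F_comp D tcD)) _.
    by rewrite lerD2l ler_pM2r ?invr_gt0 ?ltr0n // ler_nat.
  rewrite big_split /= -mulr_sumr -mulr_suml -!natr_sum; apply: lerD.
    rewrite ler_wpM2l ?ler_nat // invr_ge0; lra.
  by rewrite ler_pdivrMr ?ltr0n // mulrC -natrM ler_nat.
pose B := I :\: J; pose t := #|touching B S|; pose b := #|inside B S|.
have sum_h : (\sum_(v in S) h v = t + b)%N.
  rewrite -sum_degree; apply: eq_bigr => v vS.
  by rewrite -(saturated_degree fI vS).
have le_bt : (b <= t)%N.
  apply: subset_leq_card; apply/subsetP => e; rewrite in_inside => /andP[eB eS].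
  by rewrite in_set eB -setI_eq0 (setIidPl eS) ends_neq0.
have card_L : (#|L| + t = #|I|)%N.
  rewrite -(cardsID L I) (setIidPr (trunc_sub _ JI)); congr (_ + #|pred_of_set _|)%N.
  apply/setP => e; rewrite in_setD in_trunc in_set in_setD.
  by case: (e \in J); case: (e \in I) => //=; rewrite ?andbT ?andbF.
have OmegaT : (Omega m (delete (whole G) S) + #|K|%:Z = (m * #|~: S|)%:Z)%R.
  by rewrite (Omega_base m_gt0 bK) /= setTI.
(* The edges of [I] inside [S] form a sparse set, which bounds [Omega] of the graph induced on [S]
   from above. *)
have OmegaS : (Omega m (induced (whole G) S) + (b + #|inside J S|)%:Z <= (m * #|S|)%:Z)%R.
  have -> : (b + #|inside J S| = #|inside I S|)%N.
    rewrite addnC -(cardsID (inside J S) (inside I S)) (setIidPr (insideSl _ JI)).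
    congr (_ + #|pred_of_set _|)%N; apply/setP => e; rewrite !inE.
    by case: (e \in J); case: (e \in I); case: (ends e \subset S).
  have -> : #|S| = #|sv (induced (whole G) S)| by rewrite /= setTI.
  apply: Omega_sparse_le => //; last exact: sparseS (inside_sub _ _) sI.
  by apply/subsetP => e; rewrite !inE => /andP[_ ->].
apply: (@bounds_contradiction R c (Omega m (delete (whole G) S))%:~R
  (Omega m (induced (whole G) S))%:~R m%:R #|S|%:R (t + b)%:R t%:R b%:R
  #|inside J S|%:R #|K|%:R z%:R k%:R #|I|%:R #|L|%:R #|G|%:R #|~: S|%:R) => //.
- by rewrite ler_nat.
- by rewrite natrD.
- by rewrite -natrD card_L.
- by rewrite -natrM -natrD natr1 ler_nat.
- by rewrite -natrD cardsC.
- by have /(congr1 (fun n : int => n%:~R : R)) := OmegaT; rewrite rmorphD /= -!pmulrn natrM.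
- have : (Omega m (induced (whole G) S) + (b + #|inside J S|)%:Z)%:~R <= ((m * #|S|)%:Z)%:~R :> R.
    by rewrite ler_int.
  by rewrite rmorphD /= -!pmulrn natrD natrM.
- by rewrite -!natrM -!natrD ler_nat.
have := Omega_bound S; rewrite big_split /= sumrN -mulr_sumr -natr_sum sum_h.
by rewrite sumr_const -[_ *+ #|_|]mulr_natl.
Qed.
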